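(* Let $1\le k\le n$ and $0\le\ell\le n$ be integers, and let $w=(w_1<\dots<w_k)$ be a Grassmannian permutation with entries in $[n]$. Suppose that the ideal $G_{k,n,\ell,w}$ is non-zero. Then $G_{k,n,\ell,w}$ is non-toric if and only if all of the following hold: (i) $\ell\neq0$; (ii) $w_1\in\{2,\dots,n-k\}\setminus\{\ell\}$; (iii) $\{w_2,\dots,w_k\}\subseteq\{\ell+1,\dots,n\}\setminus\{w_1+1\}$.
   Context: $\mathbb{K}$ is a field of characteristic $0$, $\mathbf{I}_{k,n}$ is the set of $k$-subsets of $[n]=\{1,\dots,n\}$, and $X=(x_{i,j})$ is a $k\times n$ matrix of indeterminates. The Plücker ideal $G_{k,n}\subset\mathbb{K}[P_I:I\in\mathbf{I}_{k,n}]$ is the kernel of the map sending $P_I$ to the maximal minor of $X$ with column set $I$. Weight vector $\mathbf{w}_\ell$: let $M_\ell$ be the $k\times n$ matrix whose first row is $0$; whose second row has entry $\ell+1-j$ in column $j\le\ell$ and $n+\ell+1-j$ in column $j>\ell$; and whose $i$-th row, $i\ge3$, has entry $(i-1)(n+1-j)$ in column $j$. The weight $\mathbf{w}_\ell(P_I)$ is the minimum, over the terms of the minor of $X$ with column set $I$, of the sum of the entries of $M_\ell$ at the positions of the variables in the term. (This weight comes from the block diagonal matching field, which assigns to $I$ the permutation $\mathrm{id}\in S_k$ if $|I|=1$ or $|I\cap\{1,\dots,\ell\}|\neq1$, and $(1\,2)$ otherwise.) The initial ideal $\operatorname{in}_{\mathbf{w}_\ell}(G_{k,n})$ is generated by the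 forms $\operatorname{in}_{\mathbf{w}_\ell}(f)$, $f\in G_{k,n}$, where $\operatorname{in}_{\mathbf{w}_\ell}(f)$ is the sum of the terms of $f$ of minimal $\mathbf{w}_\ell$-weight. A Grassmannian permutation is recorded as $w=(w_1,\dots,w_k)$ with $1\le w_1<\dots<w_k\le n$. Let $S_{w,k}=\{I\in\mathbf{I}_{k,n}: I\not\le w\}$, where $\{i_1<\dots<i_k\}\le(w_1,\dots,w_k)$ means $i_t\le w_t$ for all $t$. The ideal $G_{k,n,\ell,w}$ is obtained from $\operatorname{in}_{\mathbf{w}_\ell}(G_{k,n})$ by setting the variables $P_I$, $I\in S_{w,k}$, to zero; equivalently it is $\big(\operatorname{in}_{\mathbf{w}_\ell}(G_{k,n})+\langle P_I:I\in S_{w,k}\rangle\big)\cap\mathbb{K}[P_I: I\in\mathbf{I}_{k,n}\setminus S_{w,k}]$, an ideal of $\mathbb{K}[P_I: I\in\mathbf{I}_{k,n}\setminus S_{w,k}]$. An ideal of a polynomial ring is toric if it is a prime ideal generated by binomials, i.e. by polynomials $c\,\mathbf{P}^\alpha-d\,\mathbf{P}^\beta$ with $c,d\in\mathbb{K}\setminus\{0\}$, $\alpha\ne\beta$. *)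

(* Defs.v *)
From HB Require Import structures.
From mathcomp Require Import all_boot all_order all_algebra.
From mathcomp.multinomials Require Import mpoly.

Set Implicit Arguments.
Unset Strict Implicit.
Unset Printing Implicit Defensive.

Import GRing.Theory.

Local Open Scope ring_scope.

(* Ideals are Prop-valued, since membership in the ideals below is not given
   by a Boolean test. *)
Section Ideals.
Variable R : comNzRingType.

Definition ideal_gen (S : R -> Prop) (f : R) : Prop :=
  exists s : seq (R * R),
    (forall x, x \in s -> S x.2) /\ f = \sum_(x <- s) x.1 * x.2.

Definition is_ideal (J : R -> Prop) : Prop :=
  [/\ J 0, forall f g, J f -> J g -> J (f + g) & forall a f, J f -> J (a * f)].

Definition prime_ideal (J : R -> Prop) : Prop :=
  [/\ is_ideal J, ~ J 1 & forall f g, J (f * g) -> J f \/ J g].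

End Ideals.

Section PolynomialRings.
Variable K : fieldType.

(* {mpoly K[#|T|]} is used as the polynomial ring over K whose variables are
   indexed by the finite type T, through enum_rank. *)
Definition var (T : finType) (t : T) : {mpoly K[#|T|]} := 'X_(enum_rank t).

Definition subst (T U : finType) (h : T -> {mpoly K[#|U|]})
    (f : {mpoly K[#|T|]}) : {mpoly K[#|U|]} :=
  f \mPo [tuple h (enum_val i) | i < #|T|].

Definition mweight (T : finType) (v : T -> nat) (m : 'X_{1..#|T|}) : nat :=
  (\sum_(t : T) v t * m (enum_rank t))%N.

(* The junk value for f = 0 is 0. *)
Definition min_weight (T : finType) (v : T -> nat) (f : {mpoly K[#|T|]}) : nat :=
  let s := [seq mweight v m | m <- msupp f] in foldr minn (head 0%N s) s.

Definition initial_form (T : finType) (v : T -> nat) (f : {mpoly K[#|T|]}) :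
    {mpoly K[#|T|]} :=
  \sum_(m <- msupp f | mweight v m == min_weight v f) f@_m *: 'X_[m].

Definition initial_ideal (T : finType) (v : T -> nat)
    (J : {mpoly K[#|T|]} -> Prop) : {mpoly K[#|T|]} -> Prop :=
  ideal_gen (fun g => exists2 f, J f & g = initial_form v f).

Definition binomial_poly (N : nat) (f : {mpoly K[N]}) : Prop :=
  exists (c d : K) (a b : 'X_{1..N}),
    [/\ c != 0, d != 0, a != b & f = c *: 'X_[a] - d *: 'X_[b]].

Definition toric (N : nat) (J : {mpoly K[N]} -> Prop) : Prop :=
  prime_ideal J /\
  exists B : {mpoly K[N]} -> Prop,
    (forall f, B f -> binomial_poly f) /\ (forall f, J f <-> ideal_gen B f).

End PolynomialRings.

(* The element j of 'I_n stands for the element j + 1 of [n] = {1, ..., n}. *)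
Section Pluecker.
Variables k n : nat.

Definition ksubset : finType := {I : {set 'I_n} | #|I| == k}.

(* enum_val lists the elements of I in increasing order. *)
Definition kelt (I : ksubset) (t : 'I_k) : 'I_n :=
  enum_val (cast_ord (esym (eqP (valP I))) t).

Definition kset_le (w : k.-tuple nat) (I : ksubset) : bool :=
  [forall t : 'I_k, ((kelt I t).+1 <= tnth w t)%N].

(* The index set of the variables that are not set to zero. *)
Definition ksubset_below (w : k.-tuple nat) : finType :=
  {I : ksubset | kset_le w I}.

(* The entries of M_l. With the 0-based row i and column j below, the 1-based
   formulas l+1-j, n+l+1-j (second row) and (i-1)(n+1-j) (later rows) become
   l-j, n+l-j and i(n-j); no subtraction is truncated. *)
Definition Mweight (l : nat) (ij : 'I_k * 'I_n) : nat :=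
  let: (i, j) := ij in
  match nat_of_ord i with
  | 0%N => 0%N
  | 1%N => if (j < l)%N then (l - j)%N else (n + l - j)%N
  | i'.+2 => (i'.+2 * (n - j))%N
  end.

Variable K : fieldType.

Definition generic_mx : 'M[{mpoly K[#|{: 'I_k * 'I_n}|]}]_(k, n) :=
  \matrix_(i, j) var K (i, j).

Definition max_minor (I : ksubset) : {mpoly K[#|{: 'I_k * 'I_n}|]} :=
  \det (colsub (kelt I) generic_mx).

Definition pluecker_ideal (f : {mpoly K[#|ksubset|]}) : Prop :=
  subst max_minor f = 0.

Definition pluecker_weight (l : nat) (I : ksubset) : nat :=
  min_weight (Mweight l) (max_minor I).

Definition in_pluecker (l : nat) : {mpoly K[#|ksubset|]} -> Prop :=
  initial_ideal (pluecker_weight l) pluecker_ideal.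

Definition kill_vars (w : k.-tuple nat) :
    {mpoly K[#|ksubset|]} -> {mpoly K[#|ksubset_below w|]} :=
  subst (fun I : ksubset =>
    if insub I is Some J then var K (J : ksubset_below w) else 0).

Definition schubert_ideal (l : nat) (w : k.-tuple nat)
    (g : {mpoly K[#|ksubset_below w|]}) : Prop :=
  exists2 f, in_pluecker l f & g = kill_vars w f.

End Pluecker.

(* Main.v *)
(* The proof computes the initial ideal as the kernel of the monomial map sending
   P_I to the signed initial term of its minor. Dimension is counted in each degree.
   Straightening shows that products of minors along chains of k-subsets span.
   The first two entries of the k-subsets are chords of a cycle with n points:
   uncrossing chords turns every product into a noncrossing one with the same row
   contents, and the block diagonal matching field only rotates the linear order in
   which the ends of a chord are read. A noncrossing family of chords is determined
   by its left and right ends for any rotation, so noncrossing products have distinct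
   initial terms; there are as many of them as chains, hence they also span, and the
   initial ideal can be no smaller than the toric kernel.
   After setting variables to zero the ideal stays toric unless some binomial of the
   kernel keeps one term and loses the other. Only the first entry of a k-subset can
   exceed its bound, and comparing the first two rows shows when this happens. *)

From HB Require Import structures.
Require Import Defs.
From mathcomp Require Import all_boot all_order all_algebra all_fingroup.
From mathcomp Require Import zify ring.
From mathcomp.multinomials Require Import mpoly.

Set Implicit Arguments.
Unset Strict Implicit.
Unset Printing Implicit Defensive.

Import GRing.Theory.

Local Open Scope ring_scope.

(* mpoly.v also defines an mweight. *)
Local Notation mweight := Defs.mweight.

(** * Leading terms with respect to a weight *)

(** That the initial ideal lies in the toric kernel is formal: in the least weight, evaluation at
    minors and evaluation at their initial terms agree. The obstacle is the converse, since initial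
    terms of products of minors need not control those of all combinations. It is settled one kernel
    binomial at a time. After scaling, its two products of minors share their leading term; their
    difference is expanded over noncrossing products of the same degree, and distinct leading
    monomials force every product used to be heavier. Subtracting this expansion makes the binomial
    an initial form. The count needs only an injection from chains to noncrossing products.
    Uncrossing keeps row contents, and row contents determine a chain; independence of the
    noncrossing products is again a matter of distinct leading monomials. Characteristic 0 enters in
    straightening, through division by the number of permutations that fix a product of two minors.
    The matching field acts on two rows, so one row is treated apart. *)

Section Monomials.
Variables (K : fieldType) (T : finType).

(** Exponent vectors are handled as multisets of variables: products along sequences of k-subsets
    then translate directly into monomials, with [perm_eq] as equality. *)
Definition seqmn (s : seq T) : 'X_{1..#|T|} := (\sum_(t <- s) U_(enum_rank t))%MM.

Definition mnseq (m : 'X_{1..#|T|}) : seq T :=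
  flatten [seq nseq (m (enum_rank t)) t | t <- enum T].

Lemma seqmnE (s : seq T) t : seqmn s (enum_rank t) = count_mem t s.
Proof.
rewrite /seqmn mnm_sumE -sum1_count [RHS]big_mkcond /=.
by apply: eq_bigr => u _; rewrite mnm1E (inj_eq enum_rank_inj); case: eqP.
Qed.

Lemma seqmn_perm (s s' : seq T) : (seqmn s = seqmn s') <-> perm_eq s s'.
Proof.
split=> [E|/(perm_big _) E]; last exact: E.
by apply/allP=> t _ /=; rewrite -!seqmnE E.
Qed.

Lemma mnseqK : cancel mnseq seqmn.
Proof.
move=> m; apply/mnmP => i; rewrite -(enum_valK i) seqmnE /mnseq.
set t := enum_val i; rewrite count_flatten -map_comp sumnE big_map big_enum /=.
rewrite (bigD1 t) //= count_nseq /= eqxx mul1n big1 ?addn0 // => u /negPf ne.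
by rewrite count_nseq /= ne.
Qed.

Lemma mnseq_perm (m : 'X_{1..#|T|}) s : m = seqmn s -> perm_eq (mnseq m) s.
Proof. by move=> E; apply/seqmn_perm; rewrite mnseqK. Qed.

Lemma prod_var (s : seq T) : \prod_(t <- s) var K t = 'X_[seqmn s].
Proof.
elim: s => [|t s IH]; first by rewrite /seqmn !big_nil mpolyX0.
by rewrite /seqmn !big_cons mpolyXD IH.
Qed.

Lemma mweightD (v : T -> nat) m m' : mweight v (m + m')%MM = (mweight v m + mweight v m')%N.
Proof.
by rewrite /mweight -big_split; apply: eq_bigr => t _; rewrite mnmDE mulnDr.
Qed.

Lemma mweight_seqmn (v : T -> nat) s : mweight v (seqmn s) = (\sum_(t <- s) v t)%N.
Proof.
elim: s => [|t s IH].
  rewrite /seqmn !big_nil /mweight big1 // => i _; by rewrite mnm0E muln0.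
rewrite /seqmn !big_cons mweightD -/(seqmn s) IH; congr addn.
rewrite /mweight (bigD1 t) //= mnm1E eqxx muln1 big1 ?addn0 // => u ne.
by rewrite mnm1E (inj_eq enum_rank_inj) eq_sym (negPf ne) muln0.
Qed.

End Monomials.

Section Subst.
Variables (K : fieldType) (T U : finType) (h : T -> {mpoly K[#|U|]}).

Lemma subst_is_linear : linear (subst h).
Proof. by move=> a p q; rewrite /subst linearP. Qed.

HB.instance Definition _ :=
  GRing.isLinear.Build K {mpoly K[#|T|]} {mpoly K[#|U|]} _ (subst h) subst_is_linear.

Lemma subst_is_monoid_morphism : monoid_morphism (subst h).
Proof. by split=> [|p q]; rewrite /subst ?rmorph1 ?rmorphM. Qed.

HB.instance Definition _ :=
  GRing.isMonoidMorphism.Build {mpoly K[#|T|]} {mpoly K[#|U|]} (subst h)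
    subst_is_monoid_morphism.

Lemma subst_var t : subst h (var K t) = h t.
Proof.
by rewrite /subst /var comp_mpolyXU -tnth_nth tnth_mktuple enum_rankK.
Qed.

Lemma subst_seqmn s : subst h 'X_[seqmn s] = \prod_(t <- s) h t.
Proof.
by rewrite -prod_var rmorph_prod; apply: eq_bigr => t _; exact: subst_var.
Qed.

Lemma substE f : subst h f = \sum_(m <- msupp f) f@_m *: subst h 'X_[m].
Proof.
by rewrite {1}(mpolyE f) linear_sum; apply: eq_bigr => m _; rewrite linearZ.
Qed.

End Subst.

Section Heavy.
Variables (K : fieldType) (U : finType) (v : U -> nat).
Implicit Types (p q : {mpoly K[#|U|]}) (m : 'X_{1..#|U|}).

Definition heavy w p := forall m, (mweight v m < w)%N -> p@_m = 0.

(** For [c != 0] the initial form of [p] is the single term [c *: 'X_[m]]. Stated as a congruence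
    modulo heavier terms, the notion is multiplicative with no condition on [c]. *)
Definition lead p m c := heavy (mweight v m).+1 (p - c *: 'X_[m]).

Lemma heavy0 w : heavy w 0.
Proof. by move=> m _; rewrite mcoeff0. Qed.

Lemma heavyD w p q : heavy w p -> heavy w q -> heavy w (p + q).
Proof. by move=> hp hq m lt; rewrite mcoeffD hp ?hq ?addr0. Qed.

Lemma heavyZ w a p : heavy w p -> heavy w (a *: p).
Proof. by move=> hp m lt; rewrite mcoeffZ hp ?mulr0. Qed.

Lemma heavy_sum w (I : Type) (r : seq I) (P : pred I) (F : I -> {mpoly K[#|U|]}) :
  (forall i, P i -> heavy w (F i)) -> heavy w (\sum_(i <- r | P i) F i).
Proof. by move=> H; apply: big_ind => //; [exact: heavy0 | exact: heavyD]. Qed.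

Lemma heavyW w w' p : (w' <= w)%N -> heavy w p -> heavy w' p.
Proof. by move=> le hp m lt; apply: hp; apply: leq_trans lt le. Qed.

Lemma heavyM w w' p q : heavy w p -> heavy w' q -> heavy (w + w') (p * q).
Proof.
move=> hp hq m lt; rewrite mcoeffM big1 // => -[k1 k2] /= /eqP E.
have [l1|g1] := ltnP (mweight v k1) w; first by rewrite hp ?mul0r.
have {}E := congr1 (mweight v) E; rewrite mweightD in E.
have l2 : (mweight v k2 < w')%N by move: (mweight v k1) (mweight v k2) E g1 => a b E; move: lt; rewrite E; lia.
by rewrite (hq k2 l2) mulr0.
Qed.

Lemma heavyX m : heavy (mweight v m) 'X_[m].
Proof. by move=> m' lt; rewrite mcoeffX; case: eqP lt => // ->; rewrite ltnn. Qed.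

Lemma lead_heavy p m c : lead p m c -> heavy (mweight v m) p.
Proof.
move=> hp; rewrite -(subrK (c *: 'X_[m]) p); apply: heavyD.
  by apply: heavyW hp.
by apply: heavyZ; exact: heavyX.
Qed.

Lemma lead_coeff p m c m' : lead p m c -> (mweight v m' <= mweight v m)%N ->
  p@_m' = c * (m == m')%:R.
Proof.
move=> hp le; have := hp m' le; rewrite mcoeffB mcoeffZ mcoeffX.
by move/eqP; rewrite subr_eq0 => /eqP.
Qed.

Lemma leadM p q m m' c c' : lead p m c -> lead q m' c' ->
  lead (p * q) (m + m')%MM (c * c').
Proof.
move=> hp hq; rewrite /lead mweightD.
have -> : p * q - (c * c') *: 'X_[(m + m')%MM] =
    (p - c *: 'X_[m]) * q + (c *: 'X_[m]) * (q - c' *: 'X_[m']).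
  rewrite mpolyXD -!mul_mpolyC mpolyCM; ring.
apply: heavyD.
  by rewrite -addSn; apply: heavyM => //; apply: lead_heavy hq.
rewrite -addnS; apply: heavyM => //; apply: heavyZ; exact: heavyX.
Qed.

Lemma lead_prod (I : Type) (s : seq I) (F : I -> {mpoly K[#|U|]}) e c :
  (forall i, lead (F i) (e i) (c i)) ->
  lead (\prod_(i <- s) F i) (\sum_(i <- s) e i)%MM (\prod_(i <- s) c i).
Proof.
move=> H; elim: s => [|i s IH]; last by rewrite !big_cons; apply: leadM.
by rewrite !big_nil /lead mpolyX0 scale1r subrr; apply: heavy0.
Qed.

(* Elements with distinct leading monomials cannot cancel: a combination is as
   heavy as the lightest of its terms. *)
Lemma heavy_comb (I : finType) (e : I -> {mpoly K[#|U|]})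
    (m : I -> 'X_{1..#|U|}) (c a : I -> K) w :
  (forall i, lead (e i) (m i) (c i)) -> (forall i, c i != 0) -> injective m ->
  heavy w (\sum_i a i *: e i) -> forall i, a i != 0 -> (w <= mweight v (m i))%N.
Proof.
move=> le c0 m_inj hw i ai; rewrite leqNgt; apply/negP => lti.
have Pi : [pred i | a i != 0] i by [].
case: (arg_minnP (fun i => mweight v (m i)) Pi) => j /= aj jmin.
have /hw : (mweight v (m j) < w)%N by apply: leq_ltn_trans (jmin i ai) lti.
rewrite linear_sum /= (bigD1 j) //= mcoeffZ (lead_coeff (le j)) // eqxx mulr1 big1.
  by move/eqP; rewrite addr0 mulf_eq0 (negPf aj) (negPf (c0 j)).
move=> i' ne; rewrite mcoeffZ; have [->|ai'] := eqVneq (a i') 0; first by rewrite mul0r.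
by rewrite (lead_coeff (le i')) ?jmin // (inj_eq m_inj) (negPf ne) !mulr0.
Qed.

Lemma min_weightE p w : (exists2 m, m \in msupp p & mweight v m = w) ->
  heavy w p -> min_weight v p = w.
Proof.
move=> [m mp <-] hp; rewrite /min_weight.
set s := [seq _ | _ <- _].
have ms : mweight v m \in s by apply: map_f.
have ge x : x \in s -> (mweight v m <= x)%N.
  case/mapP=> m' m'p ->; rewrite leqNgt; apply/negP => /hp /eqP.
  by rewrite mcoeff_eq0 m'p.
have foldr_ge x0 r : (mweight v m <= x0)%N -> {in r, forall x, mweight v m <= x}%N ->
    (mweight v m <= foldr minn x0 r)%N.
  move=> h0; elim: r => //= x r IH H; rewrite leq_min H ?mem_head //.
  by apply: IH => y yr; apply: H; rewrite inE yr orbT.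
have foldr_le x0 r : mweight v m \in r -> (foldr minn x0 r <= mweight v m)%N.
  elim: r => //= x r IH; rewrite inE geq_min => /orP[/eqP->|/IH->]; by rewrite ?leqnn ?orbT.
apply/eqP; rewrite eqn_leq foldr_le // foldr_ge //.
by apply: ge; case: (s) ms => //= x r _; rewrite mem_head.
Qed.

Lemma initial_formE p m : (initial_form v p)@_m =
  if mweight v m == min_weight v p then p@_m else 0.
Proof.
rewrite /initial_form linear_sum /=.
have [mp|mp] := boolP (m \in msupp p); last first.
  rewrite big1_seq ?(memN_msupp_eq0 mp) ?if_same // => m' /andP[_ m'p].
  by rewrite mcoeffZ mcoeffX; case: eqP m'p mp => [->->|]; rewrite ?mulr0.
rewrite big_mkcond (bigD1_seq m) ?msupp_uniq //= big1 ?addr0.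
  by case: ifP; rewrite // mcoeffZ mcoeffX eqxx mulr1.
by move=> m' ne; case: ifP; rewrite // mcoeffZ mcoeffX (negPf ne) mulr0.
Qed.

Lemma lead_min_weight p m c : c != 0 -> lead p m c -> min_weight v p = mweight v m.
Proof.
move=> c0 hp; apply: min_weightE; last exact: lead_heavy hp.
by exists m => //; rewrite mcoeff_msupp (lead_coeff hp) // eqxx mulr1.
Qed.

Lemma heavy_min_weight p : heavy (min_weight v p) p.
Proof.
have [->|nz] := eqVneq p 0; first exact: heavy0.
have := nz; rewrite -msupp_eq0; case E: (msupp p) => [//|m0 r] _.
have m0p : m0 \in msupp p by rewrite E mem_head.
have ex : exists w, has (fun m => mweight v m == w) (msupp p).
  by exists (mweight v m0); apply/hasP; exists m0.
case: (ex_minnP ex) => w /hasP[m mp /eqP mw] wmin.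
have hp : heavy w p.
  move=> m' lt; apply/eqP; rewrite mcoeff_eq0; apply: contraL lt => m'p.
  by rewrite -leqNgt; apply: wmin; apply/hasP; exists m'.
by rewrite (@min_weightE p w) //; exists m.
Qed.

(** This is how elements of an initial ideal are produced: a nonzero weight-homogeneous [p] is an
    initial form as soon as some heavier correction [q] puts [p + q] in the ideal. *)
Lemma initial_formD p q w : p != 0 -> {in msupp p, forall m, mweight v m = w} ->
  heavy w.+1 q -> initial_form v (p + q) = p.
Proof.
move=> nz pw hq.
have pE m : mweight v m != w -> p@_m = 0.
  by move=> ne; apply/eqP; rewrite mcoeff_eq0; apply: contra ne => /pw->.
have mw : min_weight v (p + q) = w.
  apply: min_weightE.
    have := nz; rewrite -msupp_eq0; case E: (msupp p) => [//|m0 r] _.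
    have m0p : m0 \in msupp p by rewrite E mem_head.
    exists m0; last exact: pw.
    by rewrite mcoeff_msupp mcoeffD hq ?pw // addr0 -mcoeff_msupp.
  by move=> m lt; rewrite mcoeffD pE ?hq ?addr0 ?neq_ltn ?lt // ltnW.
apply/mpolyP => m; rewrite initial_formE mw mcoeffD.
by case: eqP => [e|/eqP ne]; [rewrite hq ?addr0 ?e | rewrite pE].
Qed.

End Heavy.

(** * Trading a spanning family for a free family with the same index set *)

Section Counting.
Variables (K : fieldType) (V : lmodType K) (I : finType).

(** Both families are indexed by [I], so the transition matrix is square; freeness of [e'] gives it
    trivial left kernel, and its inverse expresses [e] through [e']. *)
Lemma span_of_free (e e' : I -> V) :
  (forall i, exists c : I -> K, e' i = \sum_j c j *: e j) ->
  (forall a : I -> K, \sum_i a i *: e' i = 0 -> forall i, a i = 0) ->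
  forall j, exists b : I -> K, e j = \sum_i b i *: e' i.
Proof.
move=> sp fr.
have [C CE] : exists C : I -> I -> K, forall i, e' i = \sum_j C i j *: e j.
  suff [C CE] : exists C : {ffun I -> {ffun I -> K}},
      forall i, e' i = \sum_j C i j *: e j by exists (fun i j => C i j).
  have /fin_all_exists [C CE] : forall i, exists c : {ffun I -> K},
      e' i = \sum_j c j *: e j.
    move=> i; have [c ->] := sp i; exists (finfun c).
    by apply: eq_bigr => j _; rewrite ffunE.
  by exists (finfun C) => i; rewrite ffunE.
pose M : 'M[K]_#|I| := \matrix_(i, j) C (enum_val i) (enum_val j).
have Mu : M \in unitmx.
  rewrite -row_free_unit; apply/inj_row_free => x xM.
  apply/rowP => i; rewrite mxE -(enum_valK i).
  apply: (fr (fun i => x 0 (enum_rank i))) => {i}.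
  under eq_bigr => i _ do rewrite CE scaler_sumr.
  rewrite exchange_big big1 //= => j _.
  under eq_bigr => i _ do rewrite scalerA.
  rewrite -scaler_suml; move/rowP: xM => /(_ (enum_rank j)); rewrite !mxE => xM.
  rewrite [X in X *: _](_ : _ = 0) ?scale0r // -[RHS]xM.
  rewrite (reindex (@enum_val I I)) /=; last by apply/onW_bij/enum_val_bij.
  by apply: eq_bigr => i _; rewrite enum_valK mxE enum_rankK.
move=> j; exists (fun i => invmx M (enum_rank j) (enum_rank i)).
under eq_bigr => i _ do rewrite CE scaler_sumr.
rewrite exchange_big (bigD1 j) //=.
have key j' : \sum_i invmx M (enum_rank j) (enum_rank i) * C i j' = (j == j')%:R.
  have /matrixP/(_ (enum_rank j) (enum_rank j')) := mulVmx Mu.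
  rewrite !mxE (inj_eq enum_rank_inj) => <-.
  rewrite (reindex (@enum_rank I)) /=; last by apply/onW_bij/enum_rank_bij.
  by apply: eq_bigr => i _; rewrite !mxE !enum_rankK.
under eq_bigr => i _ do rewrite scalerA.
rewrite -scaler_suml key eqxx scale1r big1 ?addr0 // => j' ne.
under eq_bigr => i _ do rewrite scalerA.
by rewrite -scaler_suml key eq_sym (negPf ne) scale0r.
Qed.

End Counting.

(** * Kernels of monomial maps *)

Section Ideals.
Variable R : comNzRingType.

Lemma ideal_gen_is_ideal (S : R -> Prop) : is_ideal (ideal_gen S).
Proof.
split.
- by exists [::]; rewrite big_nil; split=> // x; rewrite in_nil.
- move=> f g [s [sS ->]] [s' [s'S ->]]; exists (s ++ s'); rewrite big_cat.
  by split=> // x; rewrite mem_cat => /orP[/sS|/s'S].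
- move=> a f [s [sS ->]]; exists [seq (a * x.1, x.2) | x <- s]; split.
    by move=> x /mapP[y ys ->]; exact: (sS y ys).
  by rewrite big_map mulr_sumr; apply: eq_bigr => x _; rewrite mulrA.
Qed.

Lemma mem_ideal_gen (S : R -> Prop) f : S f -> ideal_gen S f.
Proof.
move=> Sf; exists [:: (1, f)]; rewrite big_seq1 mul1r; split=> // x.
by rewrite inE => /eqP->.
Qed.

Lemma ideal_gen_le (S J : R -> Prop) : is_ideal J -> (forall f, S f -> J f) ->
  forall f, ideal_gen S f -> J f.
Proof.
move=> [J0 JD JM] SJ f [s [sS ->]]; elim: s sS => [|x s IH] sS.
  by rewrite big_nil.
rewrite big_cons; apply: JD; last by apply: IH => y ys; apply: sS; rewrite inE ys orbT.
by apply: JM; apply: SJ; apply: sS; apply: mem_head.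
Qed.

Lemma ideal_sum (J : R -> Prop) (I : eqType) (r : seq I) (F : I -> R) :
  is_ideal J -> {in r, forall i, J (F i)} -> J (\sum_(i <- r) F i).
Proof.
move=> [J0 JD _] H; rewrite big_seq; apply: (big_ind J) => // i ir; exact: H.
Qed.

End Ideals.

Lemma sum_fibers (V : nmodType) (A B : eqType) (h : A -> B) (s : seq A) (F : A -> V) :
  \sum_(x <- s) F x = \sum_(y <- undup (map h s)) \sum_(x <- s | h x == y) F x.
Proof.
under [RHS]eq_bigr => y _ do rewrite big_mkcond.
rewrite [RHS]exchange_big /= [LHS]big_seq [RHS]big_seq; apply: eq_bigr => x xs.
rewrite (bigD1_seq (h x)) ?undup_uniq ?mem_undup ?map_f //= eqxx big1 ?addr0 //.
by move=> y; rewrite eq_sym => /negPf->.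
Qed.

Section MonomialMap.
Variables (K : fieldType) (T U : finType).
Variables (e : T -> 'X_{1..#|U|}) (c : T -> K).
Hypothesis c0 : forall t, c t != 0.

Definition monmap : {mpoly K[#|T|]} -> {mpoly K[#|U|]} :=
  subst (fun t => c t *: 'X_[e t]).

HB.instance Definition _ := GRing.RMorphism.on monmap.
HB.instance Definition _ := GRing.Linear.on monmap.

Definition mon_exp m := (\sum_(t <- mnseq m) e t)%MM.
Definition mon_coeff m := \prod_(t <- mnseq m) c t.

Lemma mon_coeff_neq0 m : mon_coeff m != 0.
Proof. by rewrite prodf_seq_neq0; apply/allP=> t _; rewrite c0. Qed.

Lemma mon_exp_seqmn s : mon_exp (seqmn s) = (\sum_(t <- s) e t)%MM.
Proof. exact/perm_big/mnseq_perm. Qed.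

Lemma monmapX m : monmap 'X_[m] = mon_coeff m *: 'X_[mon_exp m].
Proof.
rewrite -{1}(mnseqK m) /monmap subst_seqmn /mon_coeff /mon_exp.
elim: (mnseq m) => [|t s IH]; first by rewrite !big_nil mpolyX0 scale1r.
by rewrite !big_cons IH mpolyXD -scalerAl -scalerAr scalerA.
Qed.

Lemma monmapE f : monmap f = \sum_(m <- msupp f) (f@_m * mon_coeff m) *: 'X_[mon_exp m].
Proof.
rewrite /monmap substE; apply: eq_bigr => m _.
by rewrite -scalerA -monmapX.
Qed.

Lemma mcoeff_monmap f x : (monmap f)@_x =
  \sum_(m <- msupp f | mon_exp m == x) f@_m * mon_coeff m.
Proof.
rewrite monmapE linear_sum [RHS]big_mkcond; apply: eq_bigr => m _ /=.
by rewrite mcoeffZ mcoeffX; case: eqP; rewrite ?mulr1 ?mulr0.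
Qed.

(** Dividing by [mon_coeff] gives the image of each term coefficient 1, so the two images cancel
    when the exponents agree. *)
Definition kernel_binomial (m m' : 'X_{1..#|T|}) : {mpoly K[#|T|]} :=
  (mon_coeff m)^-1 *: 'X_[m] - (mon_coeff m')^-1 *: 'X_[m'].

Lemma monmap_kernel_binomial m m' : mon_exp m = mon_exp m' ->
  monmap (kernel_binomial m m') = 0.
Proof.
move=> E; rewrite /kernel_binomial linearB !linearZ /=.
by rewrite !monmapX scalerN !scalerA !mulVf ?mon_coeff_neq0 // E subrr.
Qed.

(** Group the monomials of [f] by their image and replace each by a representative of its fibre, at
    the cost of a kernel binomial. What remains on a fibre is a coefficient of [monmap f] times the
    representative, hence zero. The condition [m != m'] matches [binomial_poly]; the diagonal
    binomials vanish. *)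
Lemma ker_monmap_le (J : {mpoly K[#|T|]} -> Prop) : is_ideal J ->
  (forall m m', m != m' -> mon_exp m = mon_exp m' -> J (kernel_binomial m m')) ->
  forall f, monmap f = 0 -> J f.
Proof.
move=> Jid JB f f0.
(* [r x] is the chosen monomial over [x]; the default [0%MM] is never met on images of monomials of
   [f]. *)
pose r x := head 0%MM [seq m <- msupp f | mon_exp m == x].
have rE m : m \in msupp f -> mon_exp (r (mon_exp m)) = mon_exp m.
  move=> mf; have : m \in [seq m' <- msupp f | mon_exp m' == mon_exp m].
    by rewrite mem_filter eqxx.
  rewrite /r; case E: [seq _ <- _ | _] => [//|m0 s] _ /=.
  have : m0 \in [seq m' <- msupp f | mon_exp m' == mon_exp m] by rewrite E mem_head.
  by rewrite mem_filter => /andP[/eqP].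
pose G x : {mpoly K[#|T|]} := (mon_coeff (r x))^-1 *: 'X_[r x].
have G0 : \sum_(m <- msupp f) (f@_m * mon_coeff m) *: G (mon_exp m) = 0.
  rewrite (sum_fibers mon_exp) big1 // => x _.
  transitivity ((monmap f)@_x *: G x); last by rewrite f0 mcoeff0 scale0r.
  rewrite mcoeff_monmap scaler_suml; apply: eq_bigr => m /eqP<- //.
have -> : f = \sum_(m <- msupp f)
    (f@_m * mon_coeff m) *: kernel_binomial m (r (mon_exp m)).
  under eq_bigr => m _ do rewrite scalerBr.
  rewrite sumrB [X in _ - X]G0 subr0 {1}(mpolyE f); apply: eq_bigr => m _.
  by rewrite scalerA mulfK // mon_coeff_neq0.
have [J0 _ JM] := Jid.
apply: ideal_sum => // m mf; rewrite -mul_mpolyC; apply: (JM).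
have [<-|ne] := eqVneq m (r (mon_exp m)); first by rewrite /kernel_binomial subrr.
by apply: JB => //; rewrite rE.
Qed.

Lemma toric_ker_monmap : toric (fun f => monmap f = 0).
Proof.
have kid : is_ideal (fun f => monmap f = 0).
  split; first by rewrite linear0.
    by move=> f g f0 g0; rewrite linearD /= f0 g0 addr0.
  by move=> a f f0; rewrite rmorphM /= f0 mulr0.
split.
  split=> //; first by rewrite rmorph1; apply/eqP; rewrite oner_eq0.
  by move=> f g /eqP; rewrite rmorphM mulf_eq0 => /orP[] /eqP; [left|right].
exists (fun f => exists m m', [/\ m != m', mon_exp m = mon_exp m' &
    f = kernel_binomial m m']); split.
  move=> f [m [m' [ne _ ->]]]; exists (mon_coeff m)^-1, (mon_coeff m')^-1, m, m'.
  by split=> //; rewrite invr_eq0 mon_coeff_neq0.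
move=> f; split.
  apply: ker_monmap_le => [|m m' ne E]; first exact: ideal_gen_is_ideal.
  by apply: mem_ideal_gen; exists m, m'.
apply: (ideal_gen_le kid) => // g [m [m' [_ E ->]]]; exact: monmap_kernel_binomial.
Qed.

End MonomialMap.

(** * Setting variables to zero *)

Section Restriction.
Variables (K : fieldType) (T : finType) (P : pred T).
Local Notation T' := {x : T | P x}.

Definition restr_poly : {mpoly K[#|T|]} -> {mpoly K[#|{: T'}|]} :=
  subst (fun t => if insub t is Some t' then var K (t' : T') else 0).

HB.instance Definition _ := GRing.Linear.on restr_poly.

Definition ext_poly : {mpoly K[#|{: T'}|]} -> {mpoly K[#|T|]} :=
  subst (fun t' : T' => var K (val t')).

Lemma restr_poly_seqmn s : restr_poly 'X_[seqmn s] =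
  if all P s then 'X_[seqmn (pmap (insub : T -> option T') s)] else 0.
Proof.
rewrite /restr_poly subst_seqmn; elim: s => [|t s IH].
  by rewrite big_nil /= /seqmn big_nil mpolyX0.
rewrite big_cons IH /=; case: insubP => [t' Pt tE|/negPf->]; last by rewrite mul0r.
rewrite Pt /=; case: ifP => _; last by rewrite mulr0.
by rewrite -!prod_var /= big_cons.
Qed.

Lemma restr_polyE f : restr_poly f = \sum_(m <- msupp f) f@_m *: restr_poly 'X_[m].
Proof. exact: substE. Qed.

Lemma ext_polyK : cancel ext_poly restr_poly.
Proof.
move=> f; rewrite /ext_poly substE /restr_poly linear_sum /= [RHS]mpolyE.
apply: eq_bigr => m _; rewrite linearZ /= -(mnseqK m); congr (_ *: _).
have -> : subst (fun t' : T' => var K (val t')) 'X_[seqmn (mnseq m)] =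
    'X_[seqmn (map val (mnseq m))].
  by rewrite subst_seqmn -prod_var big_map.
rewrite [LHS]restr_poly_seqmn.
have -> : all P [seq val i | i <- mnseq m].
  by apply/allP=> _ /mapP[[t Pt] _ ->].
congr 'X_[seqmn _]; elim: (mnseq m) => //= t' s ->.
by rewrite valK.
Qed.

Lemma monmap_ext (U : finType) (e : T -> 'X_{1..#|U|}) (c : T -> K) g :
  monmap e c (ext_poly g) =
  monmap (fun t' : T' => e (val t')) (fun t' => c (val t')) g.
Proof.
rewrite /ext_poly [in LHS]substE linear_sum /= [RHS]substE; apply: eq_bigr => m _.
rewrite linearZ /= -(mnseqK m) !subst_seqmn rmorph_prod; congr (_ *: _).
by apply: eq_bigr => t' _; apply: subst_var.
Qed.

(** Killing variables deletes monomials but never merges two of them. *)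
Lemma mcoeff_restr_poly f (s : seq T') :
  (restr_poly f)@_(seqmn s) = f@_(seqmn (map val s)).
Proof.
rewrite restr_polyE [in RHS](mpolyE f) !linear_sum; apply: eq_bigr => m _ /=.
rewrite !mcoeffZ -(mnseqK m) restr_poly_seqmn mcoeffX; congr (_ * _).
have pK : all P (mnseq m) ->
    map val (pmap (insub : T -> option T') (mnseq m)) = mnseq m.
  elim: (mnseq m) => //= t r IH /andP[Pt /IH {}IH].
  by rewrite insubT /= IH.
case: ifP => [aP|naP].
  rewrite mcoeffX; congr (_%:R); congr nat_of_bool; apply/eqP/eqP => /seqmn_perm p.
    by apply/seqmn_perm; rewrite -[X in perm_eq X](pK aP) perm_map.
  apply/seqmn_perm; apply: (perm_map_inj val_inj); by rewrite pK.
rewrite mcoeff0; case: eqP => // /seqmn_perm p; move: naP.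
rewrite (perm_all _ p) => /negP[]; by apply/allP=> _ /mapP[[t Pt] _ ->].
Qed.

(** The first hypothesis says that each fibre of the exponent map survives entirely or is killed
    entirely. So a coefficient of the restricted image is either the full coefficient of
    [monmap e c f] or an empty sum. *)
Lemma monmap_restr (U : finType) (e : T -> 'X_{1..#|U|}) (c : T -> K) f :
  (forall s s', \sum_(t <- s) e t = \sum_(t <- s') e t -> all P s -> all P s')%MM ->
  monmap e c f = 0 ->
  monmap (fun t' : T' => e (val t')) (fun t' => c (val t')) (restr_poly f) = 0.
Proof.
move=> H f0; apply/mpolyP => x; rewrite mcoeff0.
have E m : monmap (fun t' : T' => e (val t')) (fun t' => c (val t'))
     (restr_poly 'X_[m]) = if all P (mnseq m) then monmap e c 'X_[m] else 0.
  rewrite -{1 3}(mnseqK m) restr_poly_seqmn; case: ifP => aP; last by rewrite linear0.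
  rewrite /monmap !subst_seqmn; elim: (mnseq m) aP => /= [|t s IH /andP[Pt /IH {}IH]].
    by rewrite !big_nil.
  by rewrite insubT /= !big_cons IH.
have -> : monmap (fun t' : T' => e (val t')) (fun t' => c (val t')) (restr_poly f) =
    \sum_(m <- msupp f) f@_m *: (if all P (mnseq m) then monmap e c 'X_[m] else 0).
  by rewrite restr_polyE linear_sum; apply: eq_bigr => m _; rewrite linearZ /= E.
rewrite linear_sum /=.
have [/hasP[m0 _ /andP[aP /eqP E0]]|/hasPn no] :=
    boolP (has (fun m => all P (mnseq m) && (mon_exp e m == x)) (msupp f)).
  transitivity ((monmap e c f)@_x); last by rewrite f0 mcoeff0.
  rewrite /monmap substE linear_sum; apply: eq_bigr => m _ /=.
  rewrite !mcoeffZ; case: ifP => // naP; rewrite mcoeff0.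
  rewrite -/(monmap e c 'X_[m]) monmapX mcoeffZ mcoeffX; case: eqP => Ex; last by rewrite !mulr0.
  by move: naP; rewrite (H (mnseq m0)) // -/(mon_exp e m0) -/(mon_exp e m) E0 Ex.
rewrite big1_seq // => m /= /no; case: ifP => aP /=; last by rewrite scaler0 mcoeff0.
by rewrite monmapX !mcoeffZ mcoeffX => /negPf->; rewrite !mulr0.
Qed.

End Restriction.

(** * The alternating exchange relation *)

Section Span.
Variables (K : fieldType) (V : lmodType K).
Implicit Types (E : V -> Prop) (f g : V).

Definition kspan E f : Prop :=
  exists L : seq (K * V), (forall x, x \in L -> E x.2) /\ f = \sum_(x <- L) x.1 *: x.2.

Lemma kspan_mem E f : E f -> kspan E f.
Proof.
move=> Ef; exists [:: (1, f)]; rewrite big_seq1 scale1r; split=> // x.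
by rewrite inE => /eqP->.
Qed.

Lemma kspan0 E : kspan E 0.
Proof. by exists [::]; rewrite big_nil; split=> // x; rewrite in_nil. Qed.

Lemma kspanD E f g : kspan E f -> kspan E g -> kspan E (f + g).
Proof.
move=> [s [sS ->]] [s' [s'S ->]]; exists (s ++ s'); rewrite big_cat.
by split=> // x; rewrite mem_cat => /orP[/sS|/s'S].
Qed.

Lemma kspanZ E a f : kspan E f -> kspan E (a *: f).
Proof.
move=> [s [sS ->]]; exists [seq (a * x.1, x.2) | x <- s]; split.
  by move=> x /mapP[y ys ->]; exact: (sS y ys).
by rewrite big_map scaler_sumr; apply: eq_bigr => x _; rewrite scalerA.
Qed.

Lemma kspan_sum E (I : Type) (r : seq I) (P : pred I) (F : I -> V) :
  (forall i, P i -> kspan E (F i)) -> kspan E (\sum_(i <- r | P i) F i).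
Proof. by move=> H; apply: big_ind => //; [exact: kspan0 | exact: kspanD]. Qed.

Lemma kspan_le E E' : (forall f, E f -> kspan E' f) -> forall f, kspan E f -> kspan E' f.
Proof.
move=> H f [s [sS ->]]; rewrite big_seq; apply: kspan_sum => x xs.
by apply: kspanZ; apply: H; apply: sS.
Qed.

Lemma kspan_family (I : finType) (P : pred I) (e : I -> V) f :
  kspan (fun g => exists2 i, P i & g = e i) f ->
  exists c : I -> K, f = \sum_(i | P i) c i *: e i.
Proof.
move=> [s [sS ->]]; elim: s sS => [|x s IH] sS.
  by exists (fun=> 0); rewrite big_nil big1 // => i _; rewrite scale0r.
have [|c cE] := IH; first by move=> y ys; apply: sS; rewrite inE ys orbT.
have [i Pi xi] := sS x (mem_head _ _).
exists (fun j => c j + (if j == i then x.1 else 0)).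
under [RHS]eq_bigr => j _ do rewrite scalerDl.
rewrite big_cons cE big_split addrC /=; congr (_ + _).
rewrite (bigD1 i) //= eqxx xi big1 ?addr0 // => j /andP[_ /negPf->].
by rewrite scale0r.
Qed.

End Span.

Section Exchange.
Variables (R : comNzRingType) (k n : nat) (X : 'M[R]_(k, n)).
Implicit Types (u v : 'I_k -> 'I_n).

Local Notation D u := (\det (colsub u X)).

Lemma det_colsub_perm u (s : 'S_k) : D (u \o s) = (-1) ^+ s * D u.
Proof.
have -> : colsub (u \o s) X = col_perm s (colsub u X) by apply/matrixP=> i j; rewrite !mxE.
by rewrite col_permE det_mulmx det_perm odd_permV mulrC.
Qed.

Lemma det_colsub_dup u : ~~ injectiveb u -> D u = 0.
Proof.
case/injectivePn=> i [j ne E]; rewrite -det_tr (determinant_alternate ne) // => x.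
by rewrite !mxE E.
Qed.

Lemma det_colsub_leibniz u :
  D u = \sum_(s : 'S_k) (-1) ^+ s * \prod_i X (s i) (u i).
Proof.
rewrite -det_tr; apply: eq_bigr => s _; congr (_ * _).
by apply: eq_bigr => i _; rewrite !mxE.
Qed.

Variable t : 'I_k.

(** The [k.+1] exchanged columns are numbered as slots: slots [j <= t] are the positions [0..t] of
    the right minor, slots [j > t] are the positions [t..k-1] of the left minor shifted by one.
    Position [t] thus counts in both minors. The default of [insubd] is reached only by [lo_pos] at
    slot [k], which is not a low slot. *)
Definition lo_pos (j : 'I_k.+1) : 'I_k := insubd t (j : nat).
Definition hi_pos (j : 'I_k.+1) : 'I_k := insubd t (j : nat).-1.

Definition exch_left u (y : 'I_k.+1 -> 'I_n) (i : 'I_k) :=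
  if (i < t)%N then u i else y (lift ord0 i).

Definition exch_right v (y : 'I_k.+1 -> 'I_n) (i : 'I_k) :=
  if (i <= t)%N then y (widen_ord (leqnSn k) i) else v i.

Lemma lo_pos_widen i : lo_pos (widen_ord (leqnSn k) i) = i.
Proof. by apply: val_inj; rewrite val_insubd /= ltn_ord. Qed.

Lemma hi_pos_lift i : hi_pos (lift ord0 i) = i.
Proof. by apply: val_inj; rewrite val_insubd /= add0n ltn_ord. Qed.

Lemma big_slots (T : Type) (idx : T) (op : Monoid.com_law idx) (F : 'I_k.+1 -> T) :
  \big[op/idx]_j F j =
  op (\big[op/idx]_(i < k | ~~ (i < t)%N) F (lift ord0 i))
     (\big[op/idx]_(i < k | (i <= t)%N) F (widen_ord (leqnSn k) i)).
Proof.
rewrite (bigID (fun j : 'I_k.+1 => (j <= t)%N)) /= Monoid.mulmC; congr (op _ _).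
  rewrite big_mkcond big_ord_recl /= Monoid.mul1m [RHS]big_mkcond /=.
  by apply: eq_bigr => i _; rewrite /bump /= add1n.
rewrite big_mkcond big_ord_recr /= [X in op _ X]ifF ?Monoid.mulm1.
  by rewrite [RHS]big_mkcond.
by apply/negbTE; rewrite -ltnNge.
Qed.

(* Expanding both minors by Leibniz, the sum over the permutations of the k + 1
   exchanged columns is the determinant of a matrix of size k + 1 whose rows are
   taken from only k rows. *)
Lemma exchange_alternating u v (z : 'I_k.+1 -> 'I_n) :
  \sum_(s : 'S_k.+1) (-1) ^+ s *
     (D (exch_left u (z \o s)) * D (exch_right v (z \o s))) = 0.
Proof.
pose A (r : 'S_k) := \prod_(i < k | (i < t)%N) X (r i) (u i).
pose B (r : 'S_k) := \prod_(i < k | ~~ (i <= t)%N) X (r i) (v i).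
(* [h r r' j] is the row from which the Leibniz terms [r] (left) and [r'] (right) take the column in
   slot [j]. *)
pose h (r r' : 'S_k) (j : 'I_k.+1) := if (j <= t)%N then r' (lo_pos j) else r (hi_pos j).
have reorder (a b c d e f g : R) :
    a * (b * (c * d) * (e * (f * g))) = b * e * c * g * (a * (d * f)) by ring.
have E (s : 'S_k.+1) : (-1) ^+ s *
     (D (exch_left u (z \o s)) * D (exch_right v (z \o s))) =
   \sum_(r : 'S_k) \sum_(r' : 'S_k) (-1) ^+ r * (-1) ^+ r' * A r * B r' *
      ((-1) ^+ s * \prod_j X (h r r' j) (z (s j))).
  rewrite !det_colsub_leibniz big_distrl big_distrr; apply: eq_bigr => r _.
  rewrite big_distrr big_distrr; apply: eq_bigr => r' _ /=.
  rewrite big_slots.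
  have -> : \prod_i X (r i) (exch_left u (z \o s) i) =
      A r * \prod_(i < k | ~~ (i < t)%N) X (h r r' (lift ord0 i)) (z (s (lift ord0 i))).
    rewrite (bigID (fun i : 'I_k => (i < t)%N)) /=; congr (_ * _).
      by apply: eq_bigr => i it; rewrite /exch_left it.
    apply: eq_bigr => i it; rewrite /exch_left (negPf it) /h hi_pos_lift ifF //.
    by rewrite /= /bump /= add1n (negPf it).
  have -> : \prod_i X (r' i) (exch_right v (z \o s) i) =
      (\prod_(i < k | (i <= t)%N) X (h r r' (widen_ord (leqnSn k) i))
         (z (s (widen_ord (leqnSn k) i)))) * B r'.
    rewrite (bigID (fun i : 'I_k => (i <= t)%N)) /=; congr (_ * _).
      by apply: eq_bigr => i it; rewrite /exch_right it /h /= it lo_pos_widen.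
    by apply: eq_bigr => i it; rewrite /exch_right (negPf it).
  exact: reorder.
rewrite (eq_bigr _ (fun s _ => E s)) exchange_big big1 // => r _.
rewrite exchange_big big1 // => r' _ /=.
rewrite -big_distrr /=.
have [i [j ne hE]] : exists i, exists2 j, i != j & h r r' i = h r r' j.
  apply/injectivePn; apply/negP => /injectiveP/leq_card; by rewrite !card_ord ltnn.
rewrite [X in _ * X](_ : _ = \det (\matrix_(i, j) X (h r r' i) (z j))).
  by rewrite (determinant_alternate ne) ?mulr0 // => x; rewrite !mxE hE.
apply: eq_bigr => s _; congr (_ * _); apply: eq_bigr => x _; by rewrite mxE.
Qed.

(** Such an [s] only permutes columns inside each minor, and the two resulting signs multiply to the
    sign of [s]. The induction composes [s] with [tperm j j'], where [s j' = j]: this makes [j] a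
    fixed point and stays within one block. *)
Lemma exchange_block u v (z : 'I_k.+1 -> 'I_n) (s : 'S_k.+1) :
  (forall j, (s j <= t)%N = (j <= t)%N) ->
  (-1) ^+ s * (D (exch_left u (z \o s)) * D (exch_right v (z \o s))) =
  D (exch_left u z) * D (exch_right v z).
Proof.
have [N] := ubnP #|[pred j | s j != j]|; elim: N s => // N IH s lt blk.
have [s1|[j sj]] : s = 1%g \/ exists j, s j != j.
  case: (pickP (fun j => s j != j)) => [j sj|s1]; first by right; exists j.
  by left; apply/permP => j; rewrite perm1; apply/eqP; move/negbFE: (s1 j).
  rewrite s1 odd_perm1 expr0 mul1r.
  have zz : z \o (1%g : 'S_k.+1) =1 z by move=> x; rewrite /= perm1.
  by congr (_ * _); congr (\det _); apply/matrixP => a b;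
    rewrite !mxE /exch_left /exch_right zz.
pose j' := (s^-1)%g j; have sj' : s j' = j by rewrite permKV.
have jj' : j != j' by apply: contra_neq sj => jj'; rewrite {1}jj'.
pose s' := (tperm j j' * s)%g.
have sE x : s' x = s (tperm j j' x) by rewrite permM.
have bj : (j' <= t)%N = (j <= t)%N by rewrite -blk sj'.
have blk' x : (s' x <= t)%N = (x <= t)%N.
  by rewrite sE blk; case: tpermP => // ->.
have lt' : (#|[pred x | s' x != x]| < N)%N.
  have : (#|[pred x | s' x != x]| < #|[pred x | s x != x]|)%N.
    apply: proper_card; apply/properP; split.
      apply/subsetP => x; rewrite !inE sE; case: tpermP => [->|->|//].
        by rewrite sj' eqxx.
      by rewrite sj' jj'.
    by exists j; rewrite !inE // sE tpermL sj' eqxx.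
  by move=> l; apply: leq_trans l _; rewrite -ltnS.
rewrite -(IH s') // odd_mul_tperm jj' signr_addb expr1 !mulN1r.
have [jt|jt] := leqP j t.
  have jk : (j < k)%N by apply: leq_ltn_trans jt _.
  have j'k : (j' < k)%N by apply: leq_ltn_trans (ltn_ord t); rewrite bj.
  have jE : j = widen_ord (leqnSn k) (Ordinal jk) by apply: val_inj.
  have j'E : j' = widen_ord (leqnSn k) (Ordinal j'k) by apply: val_inj.
  have tE := congr2 (fun x y => tperm x y) jE j'E.
  have -> : D (exch_left u (z \o s')) = D (exch_left u (z \o s)).
    congr (\det _); apply/matrixP => a b; rewrite !mxE /exch_left; case: ltnP => // bt.
    rewrite /= sE tpermD //; apply/eqP => /(congr1 val) /=; rewrite /bump /=.
      by move: jt; lia.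
    by move: jt; rewrite -bj; lia.
  rewrite [X in _ = _ * (_ * X)](_ : _ = - D (exch_right v (z \o s))).
    by rewrite mulrN mulNr mulrN opprK.
  have -> : D (exch_right v (z \o s')) =
      D (exch_right v (z \o s) \o tperm (Ordinal jk) (Ordinal j'k)).
    congr (\det _); apply/matrixP => a b; rewrite !mxE /exch_right /=.
    have wi : injective (widen_ord (leqnSn k)) by move=> x y /(congr1 val) /= /val_inj.
    case: (leqP b t) => bt.
      rewrite ifT; last by case: tpermP => //= _; rewrite ?bj.
      by rewrite sE tE (inj_tperm _ _ _ wi).
    rewrite tpermD ?ifF //; first by apply/negbTE; rewrite -ltnNge.
      by apply/eqP => /(congr1 val) /= e; move: jt; rewrite e leqNgt bt.
    by apply/eqP => /(congr1 val) /= e; move: jt; rewrite -bj e leqNgt bt.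
  rewrite det_colsub_perm odd_tperm -(inj_eq val_inj) /= (inj_eq val_inj) jj'.
  by rewrite expr1 mulN1r.
have j0 : (0 < j)%N by apply: leq_ltn_trans jt.
have j't : (t < j')%N by rewrite ltnNge bj -ltnNge.
have jk : (j.-1 < k)%N by have := ltn_ord j; lia.
have j'k : (j'.-1 < k)%N by have := ltn_ord j'; lia.
have jE : j = lift ord0 (Ordinal jk).
  by apply: val_inj; rewrite /= /bump /= add1n prednK.
have j'E : j' = lift ord0 (Ordinal j'k).
  by apply: val_inj; rewrite /= /bump /= add1n prednK // (leq_ltn_trans _ j't).
have tE := congr2 (fun x y => tperm x y) jE j'E.
have -> : D (exch_right v (z \o s')) = D (exch_right v (z \o s)).
  congr (\det _); apply/matrixP => a b; rewrite !mxE /exch_right; case: leqP => // bt.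
  by rewrite /= sE tpermD //; apply/eqP => /(congr1 val) /= e; lia.
rewrite [X in _ = _ * (X * _)](_ : _ = - D (exch_left u (z \o s))).
  by rewrite !mulNr mulrN opprK.
have -> : D (exch_left u (z \o s')) =
    D (exch_left u (z \o s) \o tperm (Ordinal jk) (Ordinal j'k)).
  congr (\det _); apply/matrixP => a b; rewrite !mxE /exch_left /=.
  case: (ltnP b t) => bt.
    by rewrite tpermD ?bt //; apply/eqP => /(congr1 val) /= e; lia.
  rewrite ifF; last by apply/negbTE; rewrite -leqNgt; case: tpermP => //= _; lia.
  by rewrite sE tE (inj_tperm _ _ _ (@lift_inj _ ord0)).
rewrite det_colsub_perm odd_tperm.
have -> : Ordinal jk != Ordinal j'k.
  by apply: contra jj' => /eqP e; rewrite jE j'E e.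
by rewrite expr1 mulN1r.
Qed.

End Exchange.

(** * Straightening *)

(** The positions below [s i] are the image of those below [i], so both have equally many
    predecessors. *)
Lemma perm_fix k (s : 'S_k) i : (forall j, (s j < s i)%N = (j < i)%N) -> s i = i.
Proof.
have card_lt (a : 'I_k) : #|[set j : 'I_k | (j < a)%N]| = a.
  rewrite cardsE -sum1_card (eq_bigl (fun j : 'I_k => (j < a)%N)) //.
  by rewrite -(big_ord_widen _ (fun=> 1%N)) ?sum1_card ?card_ord // ltnW.
move=> H; apply: val_inj; rewrite /= -[RHS]card_lt -[LHS]card_lt.
rewrite -[RHS](card_imset _ (@perm_inj _ s)); congr #|pred_of_set _|; apply/setP => j; rewrite !inE.
apply/idP/imsetP => [lt|[x]]; last by rewrite inE => xi ->; rewrite H.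
by exists ((s^-1)%g j); rewrite ?permKV // inE -H permKV.
Qed.

Lemma perm_incr k (s : 'S_k) : (forall i j : 'I_k, (i < j)%N -> (s i < s j)%N) -> s = 1%g.
Proof.
move=> H; apply/permP => i; rewrite perm1; apply: perm_fix => j.
case: (ltngtP j i) => [/H->//|/H lt|/val_inj->]; last by rewrite ltnn.
by apply/negbTE; rewrite -leqNgt ltnW.
Qed.

Section KSubsets.
Variables k n : nat.
Implicit Types I J : ksubset k n.

Lemma kelt_mem I t : kelt I t \in val I.
Proof. exact: enum_valP. Qed.

Lemma kelt_ltn I (i j : 'I_k) : (i < j)%N -> (kelt I i < kelt I j)%N.
Proof.
move=> lt; pose x0 := kelt I i.
rewrite /kelt !(enum_val_nth x0) /= -!(nth_map x0 0%N (@nat_of_ord n));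
  rewrite -?cardE ?(eqP (valP I)) //.
have srt : sorted ltn [seq nat_of_ord x | x <- enum (val I)].
  rewrite {1}/enum_mem -enumT; apply: (subseq_sorted ltn_trans (s2 := map val (enum 'I_n))).
    by apply: map_subseq; apply: filter_subseq.
  by rewrite val_enum_ord iota_ltn_sorted.
apply: (sorted_ltn_nth ltn_trans) => //; by rewrite inE size_map -cardE (eqP (valP I)).
Qed.

Lemma kelt_leq I (i j : 'I_k) : (i <= j)%N -> (kelt I i <= kelt I j)%N.
Proof. by rewrite leq_eqVlt => /orP[/eqP/val_inj->//|/(@kelt_ltn I)/ltnW]. Qed.

Lemma kelt_surj I x : x \in val I -> exists t, kelt I t = x.
Proof.
move=> xI; exists (cast_ord (eqP (valP I)) (enum_rank_in xI x)).
by rewrite /kelt cast_ordK enum_rankK_in.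
Qed.

Lemma kelt_ext I J : kelt I =1 kelt J -> I = J.
Proof.
move=> E; apply/val_inj/setP => x; apply/idP/idP => /kelt_surj[t <-].
  by rewrite E kelt_mem.
by rewrite -E kelt_mem.
Qed.

Lemma kset_of_inj (f : 'I_k -> 'I_n) : injective f ->
  exists I, exists s : 'S_k, f =1 kelt I \o s.
Proof.
move=> f_inj.
have cA : #|[set f i | i in 'I_k]| == k by rewrite card_imset // card_ord.
pose I : ksubset k n := Sub [set f i | i in 'I_k] cA.
have /fin_all_exists [r rE] : forall i, exists t, kelt I t = f i.
  by move=> i; apply: kelt_surj; rewrite SubK imset_f.
have r_inj : injective r by move=> i j E; apply: f_inj; rewrite -!rE E.
by exists I, (perm r_inj) => i /=; rewrite permE rE.
Qed.

Lemma kset_of_incr (f : 'I_k -> 'I_n) :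
  (forall i j : 'I_k, (i < j)%N -> (f i < f j)%N) -> exists I, kelt I =1 f.
Proof.
move=> H; have f_inj : injective f.
  by move=> i j E; case: (ltngtP i j) => [/H|/H|/val_inj//]; rewrite E ltnn.
have [I [s E]] := kset_of_inj f_inj; exists I.
have s1 : s = 1%g.
  apply: perm_incr => i j /H; rewrite !E /= => lt.
  rewrite ltnNge; apply/negP => /(@kelt_leq I) le.
  by move: lt; rewrite ltnNge le.
by move=> i; rewrite E s1 /= perm1.
Qed.

Definition kset_cle I J := [forall t, (kelt I t <= kelt J t)%N].

(** In base [k.+1] one element outweighs any [k] strictly smaller ones, and a sum over elements is
    conserved when two subsets exchange elements. *)
Definition kset_wt I := (\sum_(t < k) k.+1 ^ kelt I t)%N.

Variable K : fieldType.
Hypothesis charK0 : [pchar K] =i pred0.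

Local Notation M I := (max_minor K I).
Local Notation D u := (\det (colsub u (generic_mx k n K))).

Lemma minor_fun (f : 'I_k -> 'I_n) : D f = 0 \/
  exists I, exists a : K, D f = a *: M I /\ (\sum_t k.+1 ^ f t)%N = kset_wt I.
Proof.
have [fi|fi] := boolP (injectiveb f); last by left; apply: det_colsub_dup.
right; have [I [s fE]] := kset_of_inj (injectiveP _ fi).
exists I, ((-1) ^+ s); split.
  rewrite (_ : D f = D (kelt I \o s)); last first.
    by congr (\det _); apply/matrixP => i j; rewrite !mxE fE.
  by rewrite det_colsub_perm /max_minor scaler_sign mulr_sign.
rewrite /kset_wt [RHS](reindex_inj (@perm_inj _ s)); apply: eq_bigr => t _.
by rewrite fE.
Qed.

(** At a position [t] with [kelt J t < kelt I t], exchange the elements [0..t] of [J] with those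
    from [t] on of [I]. Each block-preserving permutation contributes [M I * M J], and their number
    is invertible in characteristic 0. Any other permutation brings into [J] an element exceeding
    all those it gave up for exchange, so the weight moves to the right factor. *)
Lemma kset_exchange I J : ~~ kset_cle I J ->
  kspan (fun f => exists I' J', [/\ f = M I' * M J',
    (kset_wt I' + kset_wt J' = kset_wt I + kset_wt J)%N & (kset_wt J < kset_wt J')%N])
  (M I * M J).
Proof.
rewrite negb_forall => /existsP[t]; rewrite -ltnNge => lt.
set E := fun f => _.
pose z (j : 'I_k.+1) := if (j <= t)%N then kelt J (lo_pos t j) else kelt I (hi_pos t j).
pose u := kelt I; pose v := kelt J.
have zl : exch_left t u z =1 u.
  move=> i; rewrite /exch_left /z hi_pos_lift /= /bump /= add1n.
  by case: (i < t)%N.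
have zr : exch_right t v z =1 v.
  by move=> i; rewrite /exch_right /z lo_pos_widen /=; case: (i <= t)%N.
have DE f g : f =1 g -> D f = D g.
  by move=> fg; congr (\det _); apply/matrixP => i j; rewrite !mxE fg.
pose Q (s : 'S_k.+1) := D (exch_left t u (z \o s)) * D (exch_right t v (z \o s)).
pose blk := [pred s : 'S_k.+1 | [forall j, (s j <= t)%N == (j <= t)%N]].
have Q0 := exchange_alternating (generic_mx k n K) t u v z.
rewrite (bigID blk) /= in Q0.
rewrite (eq_bigr (fun=> M I * M J)) in Q0; last first.
  move=> s /forallP bs; rewrite exchange_block; last by move=> j; rewrite (eqP (bs j)).
  by rewrite (DE _ _ zl) (DE _ _ zr).
rewrite sumr_const in Q0; move/eqP: Q0; rewrite addr_eq0 => /eqP Q0.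
have N0 : #|blk|%:R != 0 :> K.
  rewrite ((pcharf0P K).1 charK0) -lt0n; apply/card_gt0P; exists 1%g.
  by apply/forallP => j; rewrite perm1.
have -> : M I * M J = - #|blk|%:R^-1 *:
    \sum_(s : 'S_k.+1 | ~~ blk s) (-1) ^+ s * Q s.
  rewrite scaleNr -scalerN -Q0 -scaler_nat scalerA mulVf ?scale1r //.
apply: kspanZ; apply: kspan_sum => s.
rewrite mulr_sign -scaler_sign => nb; apply: kspanZ.
have wtQ : (\sum_i k.+1 ^ exch_left t u (z \o s) i +
    \sum_i k.+1 ^ exch_right t v (z \o s) i = kset_wt I + kset_wt J)%N.
  have wtE (y : 'I_k.+1 -> 'I_n) : (\sum_i k.+1 ^ exch_left t u y i +
      \sum_i k.+1 ^ exch_right t v y i = \sum_(i < k | (i < t)%N) k.+1 ^ u i +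
      \sum_(i < k | ~~ (i <= t)%N) k.+1 ^ v i + \sum_j k.+1 ^ y j)%N.
    rewrite (big_slots t) (bigID (fun i : 'I_k => (i < t)%N)) /=.
    rewrite [X in (_ + X)%N = _](bigID (fun i : 'I_k => (i <= t)%N)) /=.
    rewrite (eq_bigr (fun i => k.+1 ^ u i)%N); last by move=> i it; rewrite /exch_left it.
    rewrite [X in (_ + X + _)%N](eq_bigr (fun i => k.+1 ^ y (lift ord0 i))%N);
      last by move=> i it; rewrite /exch_left (negPf it).
    rewrite [X in (_ + (X + _) = _)%N](eq_bigr
      (fun i => k.+1 ^ y (widen_ord (leqnSn k) i))%N);
      last by move=> i it; rewrite /exch_right it.
    rewrite [X in (_ + (_ + X) = _)%N](eq_bigr (fun i => k.+1 ^ v i)%N);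
      last by move=> i it; rewrite /exch_right (negPf it).
    by rewrite [X in (_ + X = _)%N]addnC addnACA.
  have wz := wtE z; rewrite (eq_bigr (fun i => k.+1 ^ u i)%N) in wz; last first.
    by move=> i _; rewrite zl.
  rewrite [X in (_ + X = _)%N](eq_bigr (fun i => k.+1 ^ v i)%N) in wz; last first.
    by move=> i _; rewrite zr.
  rewrite /kset_wt wz wtE; congr (_ + _)%N.
  by rewrite [RHS](reindex_inj (@perm_inj _ s)).
(* If no low slot went to a high one, [s] would map the low slots into, hence by cardinality onto,
   themselves and preserve both blocks. *)
have [j jt sj] : exists2 j : 'I_k.+1, (j <= t)%N & (t < s j)%N.
  move: nb; rewrite negb_forall => /existsP[j0 nj0].
  pose A := [set j : 'I_k.+1 | (j <= t)%N].
  have [/existsP[j /andP[jt sj]]|no] := boolP [exists j : 'I_k.+1, (j <= t)%N && (t < s j)%N].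
    by exists j.
  have sA : s @: A = A.
    apply/eqP; rewrite eqEcard card_imset ?leqnn ?andbT; last exact: perm_inj.
    apply/subsetP => _ /imsetP[j + ->]; rewrite !inE => jt.
    by rewrite leqNgt; apply: contra no => sj; apply/existsP; exists j; rewrite jt.
  case/eqP: nj0; apply/idP/idP => j0t.
    have : s j0 \in s @: A by rewrite sA inE.
    by case/imsetP=> j; rewrite inE => jt /perm_inj->.
  have : s j0 \in s @: A by apply: imset_f; rewrite inE.
  by rewrite sA inE.
have wtJ : (kset_wt J < \sum_i k.+1 ^ exch_right t v (z \o s) i)%N.
  rewrite /kset_wt (bigID (fun i : 'I_k => (i <= t)%N)) /=.
  rewrite [X in (_ < X)%N](bigID (fun i : 'I_k => (i <= t)%N)) /=.
  rewrite [X in (_ < _ + X)%N](eq_bigr (fun i => k.+1 ^ kelt J i)%N); last first.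
    by move=> i it; rewrite /exch_right (negPf it).
  rewrite ltn_add2r.
  have jk : (j < k)%N by apply: leq_ltn_trans jt _.
  have hi : exch_right t v (z \o s) (Ordinal jk) = kelt I (hi_pos t (s j)).
    rewrite /exch_right /= jt (_ : widen_ord _ _ = j); last exact: val_inj.
    by rewrite /z leqNgt sj.
  rewrite [X in (_ < X)%N](bigD1 (Ordinal jk)) //= hi.
  apply: leq_trans (leq_addr _ _).
  apply: (@leq_trans (k.+1 ^ (kelt J t).+1)); last first.
    apply: leq_pexp2l => //; apply: leq_trans lt _; apply: kelt_leq.
    rewrite /hi_pos val_insubd; case: ifP; last by rewrite leqnn.
    by move: sj; case: (nat_of_ord (s j)).
  rewrite expnS mulSn -[X in (X < _)%N]add0n -addnS.
  apply: (@leq_trans (0 + (k * k.+1 ^ kelt J t).+1)%N); last first.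
    by rewrite add0n -addn1 addnC leq_add2r expn_gt0.
  rewrite add0n add0n ltnS -[X in (_ <= X * _)%N]card_ord -sum_nat_const.
  rewrite big_mkcond; apply: leq_sum => i _; case: ifP => // it.
  by apply: leq_pexp2l => //; apply: kelt_leq.
rewrite /Q; have [->|[I' [a [-> Ia]]]] := minor_fun (exch_left t u (z \o s)).
  by rewrite mul0r; apply: kspan0.
have [->|[J' [b [-> Jb]]]] := minor_fun (exch_right t v (z \o s)).
  by rewrite mulr0; apply: kspan0.
rewrite -scalerAl -scalerAr; do 2 apply: kspanZ; apply: kspan_mem.
by exists I', J'; split=> //; rewrite -?Ia -Jb.
Qed.

End KSubsets.

Lemma unsorted_split (T : Type) (r : rel T) (s : seq T) : ~~ sorted r s ->
  exists s1 x y s2, s = s1 ++ x :: y :: s2 /\ ~~ r x y.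
Proof.
elim: s => // x [|y s] //= IH; rewrite negb_and => /orP[nr|/IH].
  by exists [::], x, y, s.
by move=> [s1 [a [b [s2 [-> nr]]]]]; exists (x :: s1), a, b, s2.
Qed.

Section Straightening.
Variables (k n : nat) (K : fieldType).
Hypothesis charK0 : [pchar K] =i pred0.
Local Notation ksub := (ksubset k n).
Implicit Types s : seq ksub.

(** The member at position [i], counted from 0, contributes [i] times its weight, so moving weight
    to the right within an adjacent pair increases the total. *)
Fixpoint seq_wt s : nat :=
  if s is _ :: s' then (seq_wt s' + \sum_(J <- s') kset_wt J)%N else 0%N.

Lemma seq_wt_cat s s' : seq_wt (s ++ s') =
  (seq_wt s + size s * (\sum_(J <- s') kset_wt J) + seq_wt s')%N.
Proof. by elim: s => //= I s ->; rewrite big_cat /= mulSn; lia. Qed.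

Lemma seq_wt_bound : exists B, forall s, (seq_wt s <= size s * (size s * B))%N.
Proof.
pose B := (\sum_(I : ksub) kset_wt I)%N; exists B.
have sB s : (\sum_(J <- s) kset_wt J <= size s * B)%N.
  elim: s => [|I s IH]; first by rewrite big_nil.
  rewrite big_cons mulSn leq_add // /B (bigD1 I) //=; exact: leq_addr.
elim=> [|I s IH] //=; rewrite !mulSn mulnDr.
by apply: leq_trans (leq_add IH (sB s)) _; move: (size s * B)%N (size s * _)%N => a b; lia.
Qed.

Local Notation ev s := (\prod_(I <- s) max_minor K I).

(** An exchange at an adjacent unsorted pair keeps the length and raises [seq_wt] by exactly
    [kset_wt J' - kset_wt J]; as [seq_wt] is bounded for a given length, the process stops. *)
Lemma straightening s :
  kspan (fun f => exists s', [/\ sorted (@kset_cle k n) s', size s' = size s & f = ev s'])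
    (ev s).
Proof.
have [B bound] := seq_wt_bound.
have [N] := ubnP (size s * (size s * B) - seq_wt s)%N; elim: N s => // N IH s lt.
have [srt|/unsorted_split[s1 [I [J [s2 [E nle]]]]]] := boolP (sorted (@kset_cle k n) s).
  by apply: kspan_mem; exists s.
have evD s3 s4 : ev (s3 ++ s4) = ev s3 * ev s4 by rewrite big_cat.
have [L [LE LS]] := kset_exchange charK0 nle.
have -> : ev s = \sum_(x <- L) x.1 *: (ev s1 * x.2 * ev s2).
  rewrite E evD !big_cons [max_minor K I * _]mulrA LS.
  rewrite mulr_suml mulr_sumr; apply: eq_bigr => x _.
  by rewrite -!(scalerAl, scalerAr) mulrA.
rewrite big_seq; apply: kspan_sum => x /LE[I' [J' [-> tot wt]]]; apply: kspanZ.
have -> : ev s1 * (max_minor K I' * max_minor K J') * ev s2 =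
    ev (s1 ++ [:: I', J' & s2]) by rewrite evD !big_cons -!mulrA.
have sz : size (s1 ++ [:: I', J' & s2]) = size s by rewrite E !size_cat.
apply: kspan_le (IH _ _) => [f|].
  by case=> s' [srt sz' ->]; apply: kspan_mem; exists s'; rewrite sz' sz.
have := bound (s1 ++ [:: I', J' & s2]); rewrite sz.
have -> : seq_wt (s1 ++ [:: I', J' & s2]) =
    (seq_wt s + (kset_wt J' - kset_wt J))%N.
  rewrite E !seq_wt_cat /= !big_cons.
  rewrite [(kset_wt I' + _)%N]addnA tot -addnA -!addnA; congr (_ + (_ + _))%N.
  by move: (seq_wt s2) (\sum_(_ <- _) _)%N; lia.
move: lt wt; lia.
Qed.

End Straightening.

(** * Initial terms of minors *)

Section InitialTerm.
Variables (k n l : nat) (K : fieldType).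
Local Notation ksub := (ksubset k.+2 n).
Implicit Types (I : ksub) (s : 'S_k.+2).

Definition row0 : 'I_k.+2 := ord0.
Definition row1 : 'I_k.+2 := lift ord0 ord0.

(** This is the condition that exactly one element of the subset lies in the first block of [l]
    columns, the case [(1 2)] of the block diagonal matching field. *)
Definition swapped I := (kelt I row0 < l)%N && (l <= kelt I row1)%N.

Definition mf_perm I : 'S_k.+2 := if swapped I then tperm row0 row1 else 1%g.

Definition mf_col I (i : 'I_k.+2) : 'I_n := kelt I (mf_perm I i).

Definition perm_term I s : seq ('I_k.+2 * 'I_n) := [seq (i, kelt I (s i)) | i : 'I_k.+2].

Definition mf_exp I := seqmn (perm_term I (mf_perm I)).

Definition mf_sign I : K := (-1) ^+ mf_perm I.

Definition perm_wt I s := (\sum_i Mweight l (i, kelt I (s i)))%N.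

Local Arguments Mweight : simpl never.

Lemma perm_wt_D2 I s i i' : i' != i -> perm_wt I s =
  (Mweight l (i, kelt I (s i)) + Mweight l (i', kelt I (s i')) +
   \sum_(j | (j != i) && (j != i')) Mweight l (j, kelt I (s j)))%N.
Proof. by move=> ne; rewrite /perm_wt (bigD1 i) //= (bigD1 i') //= addnA. Qed.

Lemma mweight_perm_term I s : mweight (Mweight l) (seqmn (perm_term I s)) = perm_wt I s.
Proof. by rewrite mweight_seqmn big_image. Qed.

Lemma Mweight1 (j : 'I_n) :
  Mweight l (row1, j) = if (j < l)%N then (l - j)%N else (n + l - j)%N.
Proof. by []. Qed.

Lemma MweightE (i : 'I_k.+2) (j : 'I_n) : (1 < i)%N -> Mweight l (i, j) = (i * (n - j))%N.
Proof. by case: i => [[|[|i]] ?]. Qed.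

(** Row [i'] falls with slope [i'] along the columns, more steeply than any earlier row, so undoing
    an inversion lowers the weight. The jump of row 1 at column [l] goes upward and only helps. *)
Lemma perm_wt_swap I s (i i' : 'I_k.+2) : (i < i')%N -> (1 < i')%N ->
  (s i' < s i)%N -> (perm_wt I (tperm i i' * s) < perm_wt I s)%N.
Proof.
move=> ii' i'1 /(@kelt_ltn _ _ I) lt.
have ne : i' != i by rewrite neq_ltn ii' orbT.
rewrite !(perm_wt_D2 _ _ ne) !permM tpermL tpermR.
rewrite [X in (_ + X < _)%N](eq_bigr (fun j => Mweight l (j, kelt I (s j)))); last first.
  by move=> j /andP[ji ji']; rewrite permM tpermD // eq_sym.
rewrite ltn_add2r !(MweightE _ i'1).
move: (ltn_ord (kelt I (s i))) (ltn_ord (kelt I (s i'))) lt.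
move: (kelt I (s i)) (kelt I (s i')) => a b an bn ba.
case: i ii' {ne} => [[|[|i]] ii]; rewrite /Mweight /= => ii'.
- by rewrite !add0n ltn_mul2l; lia.
- have : ((i' - 1) * (n - a) < (i' - 1) * (n - b))%N by rewrite ltn_mul2l; lia.
  rewrite !mulnBl !mul1n.
  have : (n - b <= i' * (n - b))%N by rewrite leq_pmull //; lia.
  have : (n - a <= i' * (n - a))%N by rewrite leq_pmull //; lia.
  move=> h1 h2 h3; move: (i' * (n - a))%N (i' * (n - b))%N h1 h2 h3 => p q h1 h2 h3.
  by case: (ltnP b l) => bl; case: (ltnP a l) => al; lia.
have : ((i' - i.+2) * (n - a) < (i' - i.+2) * (n - b))%N by rewrite ltn_mul2l; lia.
rewrite !mulnBl.
have : (i.+2 * (n - b) <= i' * (n - b))%N by rewrite leq_mul2r; lia.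
have : (i.+2 * (n - a) <= i' * (n - a))%N by rewrite leq_mul2r; lia.
lia.
Qed.

Lemma perm_almost_incr s :
  (forall i i' : 'I_k.+2, (i < i')%N -> (1 < i')%N -> (s i < s i')%N) ->
  s = 1%g \/ s = tperm row0 row1.
Proof.
move=> H; have fix2 (i : 'I_k.+2) : (1 < i)%N -> s i = i.
  move=> i1; apply: perm_fix => j; case: (ltngtP j i) => [ji|ij|/val_inj->].
  - exact: H.
  - by apply/negbTE; rewrite -leqNgt ltnW // H // (ltn_trans i1).
  - by rewrite ltnn.
have small (i : 'I_k.+2) : (i <= 1)%N -> (s i <= 1)%N.
  move=> i1; rewrite leqNgt; apply/negP => si1; have := fix2 _ si1.
  by move/perm_inj => E; move: si1; rewrite E ltnNge i1.
have dich (i : 'I_k.+2) : (i <= 1)%N -> i = row0 \/ i = row1.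
  by case: i => [[|[|i]] lt] // _; [left|right]; apply: val_inj.
have [s0|s0] := dich _ (small row0 isT).
  left; apply/permP => i; rewrite perm1; have [/dich[->//|->]|/fix2//] := leqP i 1.
  by have [/esym|//] := dich _ (small row1 isT); rewrite -{1}s0 => /perm_inj.
right; apply/permP => i; have [/dich[->|->]|i1] := leqP i 1.
- by rewrite tpermL.
- rewrite tpermR; have [//|/esym] := dich _ (small row1 isT).
  by rewrite -{1}s0 => /perm_inj.
by rewrite fix2 // tpermD //; apply: contraTneq i1 => <-.
Qed.

(** A minimiser has no inversion whose later row is at least 2, so it is the identity or the swap of
    the first two rows. These differ only in row 1, where the lighter column is the larger one,
    unless column [l] separates the two entries. *)
Lemma perm_wt_min I s : s != mf_perm I -> (perm_wt I (mf_perm I) < perm_wt I s)%N.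
Proof.
have base : (perm_wt I (mf_perm I) <
    perm_wt I (if swapped I then 1%g else tperm row0 row1))%N.
  have wE t : perm_wt I t = (Mweight l (row1, kelt I (t row1)) +
      \sum_(i | (i != row0) && (i != row1)) Mweight l (i, kelt I (t i)))%N.
    by rewrite (@perm_wt_D2 _ _ row0 row1).
  have rest : (\sum_(i | (i != row0) && (i != row1)) Mweight l (i, kelt I (tperm row0 row1 i))
     = \sum_(i | (i != row0) && (i != row1)) Mweight l (i, kelt I ((1%g : 'S_k.+2) i)))%N.
    by apply: eq_bigr => i /andP[i0 i1]; rewrite perm1 tpermD // eq_sym.
  have := @kelt_ltn _ _ I row0 row1 isT.
  have := ltn_ord (kelt I row1).
  rewrite /mf_perm; case: ifP => sw; rewrite !wE rest ltn_add2r tpermR perm1 !Mweight1;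
    move: sw; rewrite /swapped; do 2![case: (ltnP (kelt I _) l) => ?]; lia.
have [t0 min] : exists t0, forall t, (perm_wt I t0 <= perm_wt I t)%N.
  by case: (@arg_minnP _ (1%g : 'S_k.+2) xpredT (perm_wt I) isT) => t0 _ H; exists t0 => t; apply: H.
have minE t : (forall t', (perm_wt I t <= perm_wt I t')%N) -> t = mf_perm I.
  move=> tmin; have [||E] := @perm_almost_incr t.
  - move=> i i' ii' i'1; rewrite ltnNge; apply/negP => le.
    have lt : (t i' < t i)%N.
      by rewrite ltn_neqAle le andbT (inj_eq val_inj) (inj_eq perm_inj) neq_ltn ii' orbT.
    by have := perm_wt_swap I ii' i'1 lt; rewrite ltnNge tmin.
  - move=> E; move: base (tmin (mf_perm I)); rewrite E /mf_perm; case: ifP => // _.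
    by rewrite ltnNge => /negP.
  by move: base (tmin (mf_perm I)); rewrite E /mf_perm; case: ifP => // _; rewrite ltnNge => /negP.
move=> ne; rewrite ltnNge; apply: contra ne => le; apply/eqP/minE => t'.
by apply: leq_trans le _; rewrite -(minE _ min).
Qed.

Lemma lead_max_minor I : lead (Mweight l) (max_minor K I) (mf_exp I) (mf_sign I).
Proof.
have E : max_minor K I = \sum_(s : 'S_k.+2) ((-1) ^+ s : K) *: 'X_[seqmn (perm_term I s)].
  apply: eq_bigr => s _; rewrite mulr_sign -scaler_sign; congr (_ *: _).
  by rewrite -prod_var big_image; apply: eq_bigr => i _; rewrite !mxE.
rewrite /lead E (bigD1 (mf_perm I)) //=.
rewrite -/(mf_sign I) -/(mf_exp I) addrAC subrr add0r.
apply: heavy_sum => s ne; apply: heavyZ.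
apply: (heavyW _ (@heavyX K _ (Mweight l) (seqmn (perm_term I s)))); rewrite !mweight_perm_term; exact: perm_wt_min.
Qed.

Lemma mf_sign_neq0 I : mf_sign I != 0.
Proof. by rewrite signr_eq0. Qed.

Lemma pluecker_weightE I : pluecker_weight K l I = mweight (Mweight l) (mf_exp I).
Proof. exact: lead_min_weight (mf_sign_neq0 I) (@lead_max_minor I). Qed.

Lemma mf_expE I i j : mf_exp I (enum_rank (i, j)) = (mf_col I i == j).
Proof.
rewrite seqmnE count_map -sum1_count big_enum_cond /=.
rewrite big_mkcond (bigD1 i) //= xpair_eqE eqxx /= big1 ?addn0.
  by rewrite /mf_col; case: eqP.
by move=> i' /negPf ne; rewrite xpair_eqE ne.
Qed.

Lemma mf_exp_rows (s s' : seq ksub) :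
  (\sum_(I <- s) mf_exp I = \sum_(I <- s') mf_exp I)%MM <->
  forall i, perm_eq [seq mf_col J i | J <- s] [seq mf_col J i | J <- s'].
Proof.
have cE (r : seq ksub) i j : (\sum_(I <- r) mf_exp I)%MM (enum_rank (i, j)) =
    count_mem j [seq mf_col J i | J <- r].
  rewrite mnm_sumE count_map -sum1_count [RHS]big_mkcond; apply: eq_bigr => I _.
  by rewrite mf_expE /=; case: eqP.
split=> [E i|H]; first by apply/allP => j _ /=; rewrite -!cE E.
apply/mnmP => x; rewrite -(enum_valK x); case: (enum_val x) => i j.
by rewrite !cE; have /seq.permP := H i; apply.
Qed.

End InitialTerm.

(** * Noncrossing chords *)

Definition nc_pairs (p : seq (nat * nat)) : Prop := forall x y, x \in p -> y \in p ->
  ~~ [&& (x.1 < y.1)%N, (y.1 < x.2)%N & (x.2 < y.2)%N].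

(* The smallest right end must be matched with the largest left end below it. *)
Lemma nc_pairs_unique (p p' : seq (nat * nat)) :
  all (fun x => x.1 < x.2)%N p -> all (fun x => x.1 < x.2)%N p' ->
  nc_pairs p -> nc_pairs p' ->
  perm_eq (unzip1 p) (unzip1 p') -> perm_eq (unzip2 p) (unzip2 p') -> perm_eq p p'.
Proof.
have [N] := ubnP (size p); elim: N p p' => // N IH p p' szN lp lp' np np' e1 e2.
have szp' : size p' = size p by rewrite -(size_map snd) -(perm_size e2) size_map.
have [p0|[x0 x0p]] : p = [::] \/ exists x, x \in p.
  by case: (p) => [|x q]; [left | right; exists x; rewrite mem_head].
  by move: szp'; rewrite p0; case: (p').
have exb : exists b, b \in unzip2 p by exists x0.2; apply: map_f.
case: (ex_minnP exb) => b bp bmin.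
have exa : exists a, (a \in unzip1 p) && (a < b)%N.
  have /mapP[x xp ->] := bp; exists x.1; rewrite map_f //=.
  exact: (allP lp).
have bnd a : (a \in unzip1 p) && (a < b)%N -> (a <= b)%N by case/andP=> _ /ltnW.
case: (ex_maxnP exa bnd) => a /andP[ap ab] amax.
have key q : all (fun x => x.1 < x.2)%N q -> nc_pairs q ->
    perm_eq (unzip1 p) (unzip1 q) -> perm_eq (unzip2 p) (unzip2 q) -> (a, b) \in q.
  move=> lq nq eq1 eq2.
  have /mapP[[a1 b1] xq /= aE] : a \in unzip1 q by rewrite -(perm_mem eq1).
  have /mapP[[a2 b2] yq /= bE] : b \in unzip2 q by rewrite -(perm_mem eq2).
  move: xq yq; rewrite -aE -bE => xq yq {aE bE}.
  have b1b : (b <= b1)%N.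
    by apply: bmin; rewrite (perm_mem eq2); apply/mapP; exists (a, b1).
  have a2a : (a2 <= a)%N.
    apply: amax; rewrite (perm_mem eq1); apply/andP; split.
      by apply/mapP; exists (a2, b).
    exact: (allP lq _ yq).
  have [e|ne1] := eqVneq a2 a; first by rewrite -e.
  have [e|ne2] := eqVneq b1 b; first by rewrite -e.
  (* Otherwise [a2 < a < b < b1], and the chords [(a2, b)] and [(a, b1)] cross. *)
  by have := nq _ _ yq xq; rewrite /= ab !ltn_neqAle ne1 a2a [_ == _]eq_sym ne2 b1b.
have xp := key p lp np (perm_refl _) (perm_refl _).
have xp' := key p' lp' np' e1 e2.
have pE := perm_to_rem xp; have p'E := perm_to_rem xp'.
apply: (perm_trans pE); rewrite perm_sym; apply: (perm_trans p'E).
rewrite perm_sym perm_cons; apply: IH.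
- by rewrite size_rem // -ltnS; case: (p) xp szN.
- by apply/allP => x /mem_rem; apply: (allP lp).
- by apply/allP => x /mem_rem; apply: (allP lp').
- by move=> x y /mem_rem xr /mem_rem yr; apply: np.
- by move=> x y /mem_rem xr /mem_rem yr; apply: np'.
- have := perm_map fst pE; have := perm_map fst p'E; rewrite /= => h1 h2.
  by rewrite -(perm_cons a) -(permPl h2) -(permPr h1).
have := perm_map snd pE; have := perm_map snd p'E; rewrite /= => h1 h2.
by rewrite -(perm_cons b) -(permPl h2) -(permPr h1).
Qed.

Section Noncrossing.
Variables (k n : nat).
Local Notation ksub := (ksubset k.+2 n).
Local Notation row0 := (row0 k).
Local Notation row1 := (row1 k).
Implicit Types (I J : ksub) (s : seq ksub).

Definition same_rows s s' :=
  forall i, perm_eq [seq kelt J i | J <- s] [seq kelt J i | J <- s'].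

Definition crossing I J := [&& (kelt I row0 < kelt J row0)%N,
  (kelt J row0 < kelt I row1)%N & (kelt I row1 < kelt J row1)%N].

Definition noncrossing s := all (fun I => all (fun J => ~~ crossing I J) s) s.

Lemma same_rows_trans s s' s'' : same_rows s s' -> same_rows s' s'' -> same_rows s s''.
Proof. by move=> H H' i; apply: perm_trans (H i) (H' i). Qed.

Lemma same_rows_perm s s' : perm_eq s s' -> same_rows s s'.
Proof. by move=> p i; apply: perm_map. Qed.

Lemma row0_or_pos (i : 'I_k.+2) : i = row0 \/ (row1 <= i)%N.
Proof. by case: i => [[|i] lt]; [left; apply: val_inj | right]. Qed.

(** Exchanging the first entries makes the chords nested. With ends [a < b < c < d] the sum of
    products drops from [a c + b d] to [b c + a d], that is by [(b - a)(d - c)]; this decrease makes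
    repeated uncrossing terminate. *)
Lemma uncross I J : crossing I J -> exists I' J',
  [/\ same_rows [:: I; J] [:: I'; J'] &
    (kelt I' row0 * kelt I' row1 + kelt J' row0 * kelt J' row1 <
     kelt I row0 * kelt I row1 + kelt J row0 * kelt J row1)%N].
Proof.
case/and3P=> h1 h2 h3.
have [I' I'E] : exists I', kelt I' =1 fun i => if i == row0 then kelt J row0 else kelt I i.
  apply: kset_of_incr => i j ij.
  have [ji|j1] := row0_or_pos j; first by move: ij; rewrite ji.
  have jn0 : j == row0 = false by apply/negbTE; apply: contraTneq ij => ->.
  rewrite jn0; case: eqP => [_|_]; last exact: kelt_ltn.
  by apply: leq_trans h2 _; apply: kelt_leq.
have [J' J'E] : exists J', kelt J' =1 fun i => if i == row0 then kelt I row0 else kelt J i.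
  apply: kset_of_incr => i j ij.
  have jn0 : j == row0 = false by apply/negbTE; apply: contraTneq ij => ->.
  rewrite jn0; case: eqP => [i0|_]; last exact: kelt_ltn.
  by apply: ltn_trans h1 _; apply: kelt_ltn; rewrite -i0.
exists I', J'; split.
  move=> i /=; rewrite I'E J'E; case: eqP => [->|_]; last exact: perm_refl.
  by apply/allP => x _ /=; rewrite addnCA.
rewrite !I'E !J'E /=; move: h1 h2 h3.
move: (nat_of_ord (kelt I row0)) (nat_of_ord (kelt I row1)) => a c.
move: (nat_of_ord (kelt J row0)) (nat_of_ord (kelt J row1)) => b d.
move=> ab bc cd; rewrite -(subnK (ltnW ab)) -(subnK (ltnW cd)) !mulnDl !mulnDr.
have : (0 < (b - a) * (d - c))%N by rewrite muln_gt0 !subn_gt0 ab cd.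
lia.
Qed.

Lemma noncrossing_exists s :
  exists s', [/\ size s' = size s, same_rows s s' & noncrossing s'].
Proof.
have [N] := ubnP (\sum_(J <- s) kelt J row0 * kelt J row1)%N.
elim: N s => // N IH s lt.
have [nc|] := boolP (noncrossing s); first by exists s; split=> // i.
case/allPn=> I Is /allPn[J Js /negbNE cr].
have IJ : J != I by apply: contraTneq cr => ->; rewrite /crossing ltnn.
have Js' : J \in rem I s by move: Js; rewrite (perm_mem (perm_to_rem Is)) inE (negPf IJ).
set r := rem J (rem I s).
have sE : perm_eq s ([:: I; J] ++ r).
  by apply: perm_trans (perm_to_rem Is) _; rewrite perm_cons; apply: perm_to_rem.
have [I' [J' [rows lt']]] := uncross cr.
have [|s' [sz rows' nc']] := IH ([:: I'; J'] ++ r).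
  rewrite -ltnS; apply: leq_trans lt; rewrite ltnS (perm_big _ sE) /= !big_cons !addnA.
  by rewrite ltn_add2r.
exists s'; split=> //; first by rewrite sz (perm_size sE).
apply: same_rows_trans (same_rows_perm sE) _; apply: same_rows_trans rows' => i.
by rewrite !map_cat perm_cat2r.
Qed.

End Noncrossing.

(** * Matched pairs as chords in the rotated column order *)

Section Rotation.
Variables (k n l : nat).
Hypothesis l_le_n : (l <= n)%N.
Local Notation ksub := (ksubset k.+2 n).
Local Notation row0 := (row0 k).
Local Notation row1 := (row1 k).
Implicit Types (I J : ksub) (s : seq ksub).

Lemma mf_col_row0 I : mf_col l I row0 = kelt I (if swapped l I then row1 else row0).
Proof. by rewrite /mf_col /mf_perm; case: ifP; rewrite ?tpermL ?perm1. Qed.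

Lemma mf_col_row1 I : mf_col l I row1 = kelt I (if swapped l I then row0 else row1).
Proof. by rewrite /mf_col /mf_perm; case: ifP; rewrite ?tpermR ?perm1. Qed.

Lemma mf_col_tail I (i : 'I_k.+2) : (1 < i)%N -> mf_col l I i = kelt I i.
Proof.
move=> i1; rewrite /mf_col /mf_perm; case: ifP; rewrite ?perm1 // tpermD //;
  by apply: contraTneq i1 => <-.
Qed.

(** The cyclic order starting at column [l], where row 1 of the weight matrix jumps. In this order
    the pair read by the matching field is increasing, whether swapped or not. *)
Definition rot (j : nat) := if (j < l)%N then (j + n - l)%N else (j - l)%N.
Definition unrot (j : nat) := if (j < n - l)%N then (j + l)%N else (j + l - n)%N.

Lemma rotK (j : 'I_n) : unrot (rot j) = j.
Proof.
have := ltn_ord j; rewrite /rot /unrot; case: (ltnP j l) => jl jn.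
  by rewrite ifF; lia.
by rewrite ifT; lia.
Qed.

Definition chord I := (rot (mf_col l I row0), rot (mf_col l I row1)).

Lemma chord_lt I : ((chord I).1 < (chord I).2)%N.
Proof.
rewrite /chord /= mf_col_row0 mf_col_row1 /rot.
have := @kelt_ltn _ _ I row0 row1 isT; have := ltn_ord (kelt I row1).
rewrite /swapped; case: (ltnP (kelt I row0) l) => h0; case: (leqP l (kelt I row1)) => h1 /=;
  rewrite ?h0 ?h1 ?(leq_gtF h0) ?(leq_gtF h1); lia.
Qed.

(* The matched pairs are ordered for the cyclically rotated order, and crossing
   is invariant under rotation. *)
Lemma chord_noncrossing s : noncrossing s -> nc_pairs (map chord s).
Proof.
move=> nc _ _ /mapP[I Is ->] /mapP[J Js ->].
have := allP (allP nc I Is) J Js; have := allP (allP nc J Js) I Is.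
rewrite /crossing /chord /= !mf_col_row0 !mf_col_row1 /rot.
have := @kelt_ltn _ _ I row0 row1 isT; have := ltn_ord (kelt I row1).
have := @kelt_ltn _ _ J row0 row1 isT; have := ltn_ord (kelt J row1).
rewrite /swapped.
case: (ltnP (kelt I row0) l) => h0; case: (leqP l (kelt I row1)) => h1 /=;
case: (ltnP (kelt J row0) l) => h2; case: (leqP l (kelt J row1)) => h3 /=;
  rewrite ?h0 ?h1 ?(leq_gtF h0) ?(leq_gtF h1) ?h2 ?h3 ?(leq_gtF h2) ?(leq_gtF h3); lia.
Qed.

Lemma chordK0 I : minn (unrot (chord I).1) (unrot (chord I).2) = kelt I row0.
Proof.
have lt := @kelt_ltn _ _ I row0 row1 isT.
rewrite /chord /= !rotK mf_col_row0 mf_col_row1; case: ifP => _; lia.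
Qed.

Lemma chordK1 I : maxn (unrot (chord I).1) (unrot (chord I).2) = kelt I row1.
Proof.
have lt := @kelt_ltn _ _ I row0 row1 isT.
rewrite /chord /= !rotK mf_col_row0 mf_col_row1; case: ifP => _; lia.
Qed.

(** Rows 0 and 1 of the initial monomial list the left and right ends of the chords, which determine
    a noncrossing family. Undoing the rotation, the minimum and maximum of each chord give back the
    first two entries. Only row contents are recovered, not the subsets themselves. *)
Lemma noncrossing_rows s s' : noncrossing s -> noncrossing s' ->
  (forall i, perm_eq [seq mf_col l J i | J <- s] [seq mf_col l J i | J <- s']) ->
  same_rows s s'.
Proof.
move=> nc nc' H.
have P : perm_eq (map chord s) (map chord s').
  apply: nc_pairs_unique.
  - by apply/allP => _ /mapP[I _ ->]; apply: chord_lt.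
  - by apply/allP => _ /mapP[I _ ->]; apply: chord_lt.
  - exact: chord_noncrossing.
  - exact: chord_noncrossing.
  - by have := perm_map (fun j : 'I_n => rot j) (H row0); rewrite /unzip1 -!map_comp.
  by have := perm_map (fun j : 'I_n => rot j) (H row1); rewrite /unzip2 -!map_comp.
move=> i; apply: (perm_map_inj (@ord_inj n)); rewrite -!map_comp.
case: (ltnP 1 i) => i1.
  have := perm_map (@nat_of_ord n) (H i); rewrite -!map_comp.
  by congr perm_eq; apply: eq_map => I /=; rewrite mf_col_tail.
have [->|->] : i = row0 \/ i = row1.
    by case: i i1 => [[|[|i]] lt] // _; [left|right]; apply: val_inj.
  have := perm_map (fun x => minn (unrot x.1) (unrot x.2)) P; rewrite -!map_comp.
  by congr perm_eq; apply: eq_map => I; exact: chordK0.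
have := perm_map (fun x => maxn (unrot x.1) (unrot x.2)) P; rewrite -!map_comp.
by congr perm_eq; apply: eq_map => I; exact: chordK1.
Qed.

End Rotation.

(** * The initial ideal of the Pluecker ideal *)

Section InitialIdeal.
Variables (k n l : nat) (K : fieldType).
Hypothesis charK0 : [pchar K] =i pred0.
Hypothesis l_le_n : (l <= n)%N.
Local Notation ksub := (ksubset k.+2 n).
Local Notation ev s := (\prod_(I <- s) max_minor K I).
Local Notation wt := (pluecker_weight K l).
Local Notation sgn := (@mf_sign k n l K).
Local Notation mexp := (@mf_exp k n l).

(** Along a chain every row is weakly increasing, so its contents fix its order. *)
Lemma sorted_same_rows (s s' : seq ksub) : sorted (@kset_cle k.+2 n) s ->
  sorted (@kset_cle k.+2 n) s' -> same_rows s s' -> s = s'.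
Proof.
move=> srt srt' H.
have E i : [seq nat_of_ord (kelt J i) | J <- s] = [seq nat_of_ord (kelt J i) | J <- s'].
  apply: (sorted_eq leq_trans anti_leq).
  - by apply: homo_sorted srt => I J /forallP; apply.
  - by apply: homo_sorted srt' => I J /forallP; apply.
  by have := perm_map (@nat_of_ord n) (H i); rewrite -!map_comp.
have sz : size s = size s' by have := congr1 size (E (row0 k)); rewrite !size_map.
elim: s s' sz E {srt srt' H} => [|I s IH] [|J s'] //= [sz] E.
congr (_ :: _); first by apply: kelt_ext => i; apply: val_inj; case: (E i).
by apply: IH => // i; case: (E i).
Qed.

Lemma lead_ev (s : seq ksub) :
  lead (Mweight l) (ev s) (\sum_(I <- s) mexp I)%MM (\prod_(I <- s) sgn I).
Proof. by apply: lead_prod => I; apply: lead_max_minor. Qed.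

Lemma prod_sign_neq0 (s : seq ksub) : \prod_(I <- s) sgn I != 0.
Proof. by rewrite prodf_seq_neq0; apply/allP => J _; apply: mf_sign_neq0. Qed.

Lemma lead_substX m : lead (Mweight l) (subst (@max_minor k.+2 n K) 'X_[m])
  (mon_exp mexp m) (mon_coeff sgn m).
Proof. by rewrite -{1}(mnseqK m) subst_seqmn; apply: lead_ev. Qed.

Lemma mweight_sum (s : seq ksub) : mweight (Mweight l) (\sum_(I <- s) mexp I)%MM =
  mweight wt (seqmn s).
Proof.
rewrite mweight_seqmn; elim: s => [|I s IH].
  rewrite !big_nil /Defs.mweight big1 // => x _; by rewrite mnm0E muln0.
by rewrite !big_cons mweightD IH pluecker_weightE.
Qed.

Lemma mweight_mon_exp m : mweight (Mweight l) (mon_exp mexp m) = mweight wt m.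
Proof. by rewrite /mon_exp mweight_sum mnseqK. Qed.

(** In the least weight of [f], the image of the initial form has the same coefficients as
    [subst max_minor f], which is zero: heavier monomials of [f] contribute nothing there. *)
Lemma in_pluecker_ker f : in_pluecker l f -> monmap mexp sgn f = 0.
Proof.
have kid : is_ideal (fun f => monmap mexp sgn f = 0).
  by have [[]] := toric_ker_monmap mexp (@mf_sign_neq0 k n l K).
apply: (ideal_gen_le kid) => {f} _ [f f0 ->].
apply/mpolyP => x; rewrite mcoeff0.
rewrite /initial_form (linear_sum (monmap mexp sgn)) linear_sum /=.
have [xw|xw] := eqVneq (mweight (Mweight l) x) (min_weight wt f); last first.
  rewrite big1 // => m /eqP mw; rewrite linearZ /= monmapX !mcoeffZ mcoeffX.
  case: eqP => [e|_]; last by rewrite !mulr0.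
  by case/negP: xw; rewrite -e mweight_mon_exp mw.
transitivity ((subst (@max_minor k.+2 n K) f)@_x); last by rewrite f0 mcoeff0.
rewrite substE linear_sum big_mkcond big_seq [RHS]big_seq; apply: eq_bigr => m mf /=.
have wm : (min_weight wt f <= mweight wt m)%N.
  rewrite leqNgt; apply: contraL mf => lt.
  by rewrite -mcoeff_eq0 (heavy_min_weight lt).
rewrite mcoeffZ (lead_coeff (@lead_substX m)); last by rewrite xw mweight_mon_exp.
case: eqP => [_|ne]; first by rewrite linearZ /= monmapX !mcoeffZ mcoeffX.
case: eqP => [e|_]; last by rewrite !mulr0.
by case: ne; rewrite -mweight_mon_exp e.
Qed.

Lemma size_mf_exp (s s' : seq ksub) :
  (\sum_(I <- s) mexp I = \sum_(I <- s') mexp I)%MM -> size s = size s'.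
Proof.
move/mf_exp_rows => /(_ (row0 k)) /perm_size; by rewrite !size_map.
Qed.

(* Sorted products of minors span, and by noncrossing uniqueness there are as
   many leading monomials as sorted products: so noncrossing products span too. *)
Lemma noncrossing_span d : exists I : finType, exists g : I -> seq ksub,
  injective (fun i => \sum_(J <- g i) mexp J)%MM /\
  (forall s, size s = d -> exists c : I -> K, ev s = \sum_i c i *: ev (g i)).
Proof.
pose St : finType := {t : d.-tuple ksub | sorted (@kset_cle k.+2 n) t}.
have /fin_all_exists [g gP] : forall t : St, exists s : d.-tuple ksub,
    same_rows (val t) s /\ noncrossing s.
  move=> t; have [s [sz rows nc]] := noncrossing_exists (val t).
  have sz' : size s == d by rewrite sz size_tuple.
  by exists (Tuple sz').
have g_inj : injective (fun t => \sum_(J <- g t) mexp J)%MM.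
  move=> t t' /mf_exp_rows H; have [r1 nc1] := gP t; have [r2 nc2] := gP t'.
  have r3 := noncrossing_rows l_le_n nc1 nc2 H.
  apply: val_inj; apply: val_inj; apply: (sorted_same_rows (valP t) (valP t')).
  move=> i; apply: perm_trans (r1 i) _; apply: perm_trans (r3 i) _.
  by rewrite perm_sym.
have std (s : seq ksub) : size s = d ->
    exists c : St -> K, ev s = \sum_t c t *: ev (val t).
  move=> sz; apply: (@kspan_family _ _ _ xpredT (fun t : St => ev (val t))).
  apply: kspan_le (straightening charK0 s) => f [s' [srt sz' ->]]; apply: kspan_mem.
  have szd : size s' == d by rewrite sz' sz.
  by exists (exist (fun t : d.-tuple ksub => sorted (@kset_cle k.+2 n) t) (Tuple szd) srt).
exists St, (fun t => val (g t)); split=> // s sz.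
(* Chains span the noncrossing products and the latter are free, so the expansion can be
   reversed. *)
have back : forall t : St, exists b : St -> K, ev (val t) = \sum_t' b t' *: ev (g t').
  apply: span_of_free => [t|a a0 t]; first by apply: std; rewrite size_tuple.
  apply/eqP/negPn/negP => at0.
  (* The zero combination is heavy for every bound; one above the weight of the leading monomial of
     index [t] contradicts [heavy_comb]. *)
  have hv : heavy (Mweight l) (mweight (Mweight l) (\sum_(J <- g t) mexp J)%MM).+1
      (\sum_t a t *: ev (g t)) by rewrite a0; apply: heavy0.
  have := heavy_comb (fun t => @lead_ev (g t)) (fun t => prod_sign_neq0 (g t)) g_inj hv at0.
  by rewrite ltnn.
have /fin_all_exists [b bE] : forall t : St, exists b : {ffun St -> K},
    ev (val t) = \sum_t' b t' *: ev (g t').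
  move=> t; have [b ->] := back t; exists (finfun b).
  by apply: eq_bigr => t' _; rewrite ffunE.
have [c ->] := std s sz.
exists (fun t' => \sum_t c t * b t t').
under eq_bigr => t _ do rewrite bE scaler_sumr.
rewrite exchange_big; apply: eq_bigr => t' _ /=.
by rewrite scaler_suml; apply: eq_bigr => t _; rewrite scalerA.
Qed.

(** The leading terms cancel, so [subst max_minor f] is heavier than the weight [w] of [f], and by
    [heavy_comb] so is every noncrossing product in its expansion. Subtracting the matching
    monomials from [f] gives a Pluecker relation with initial form [f]. *)
Lemma kernel_binomial_in_pluecker m m' : m != m' -> mon_exp mexp m = mon_exp mexp m' ->
  in_pluecker l (kernel_binomial sgn m m').
Proof.
move=> ne E; set f := kernel_binomial sgn m m'.
have sz : size (mnseq m') = size (mnseq m) by apply: size_mf_exp; rewrite -/(mon_exp _ _) -E.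
have [I [g [g_inj gS]]] := noncrossing_span (size (mnseq m)).
have evX m0 : subst (@max_minor k.+2 n K) 'X_[m0] = ev (mnseq m0).
  by rewrite -{1}(mnseqK m0) subst_seqmn.
have [c cE] : exists c : I -> K,
    subst (@max_minor k.+2 n K) f = \sum_i c i *: ev (g i).
  have [a aE] := gS _ erefl; have [a' a'E] := gS _ sz.
  exists (fun i => (mon_coeff sgn m)^-1 * a i - (mon_coeff sgn m')^-1 * a' i).
  rewrite /f /kernel_binomial linearB !linearZ /= scalerN !evX aE a'E !scaler_sumr -sumrB.
  by apply: eq_bigr => i _; rewrite scalerBl !scalerA.
pose w := mweight wt m.
have wm' : mweight wt m' = w by rewrite -mweight_mon_exp -E mweight_mon_exp.
have C0 m0 : mon_coeff sgn m0 != 0 by apply: mon_coeff_neq0; apply: mf_sign_neq0.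
have hv : heavy (Mweight l) w.+1 (\sum_i c i *: ev (g i)).
  rewrite -cE /f /kernel_binomial linearB !linearZ /= scalerN.
  have := @lead_substX m; have := @lead_substX m'; rewrite /lead !mweight_mon_exp wm' -/w.
  set p := subst _ _; set p' := subst _ _ => h' h.
  have -> : (mon_coeff sgn m)^-1 *: p' - (mon_coeff sgn m')^-1 *: p =
     (mon_coeff sgn m)^-1 *: (p' - mon_coeff sgn m *: 'X_[mon_exp mexp m]) +
     (- (mon_coeff sgn m')^-1) *: (p - mon_coeff sgn m' *: 'X_[mon_exp mexp m']).
    rewrite !scalerBr !scalerA mulNr !mulVf // E !scaleNr scale1r opprK.
    by rewrite addrACA addNr addr0.
  by apply: heavyD; apply: heavyZ.
have cw i : c i != 0 -> (w < mweight wt (seqmn (g i)))%N.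
  move=> ci; rewrite -mweight_sum.
  exact: (heavy_comb (fun t => @lead_ev (g t)) (fun t => prod_sign_neq0 (g t)) g_inj hv ci).
apply: mem_ideal_gen; exists (f + \sum_i (- c i) *: 'X_[seqmn (g i)]).
  rewrite /pluecker_ideal linearD /= cE linear_sum -big_split big1 // => i _ /=.
  by rewrite linearZ /= subst_seqmn scaleNr subrr.
have fm : f@_m = (mon_coeff sgn m)^-1.
  by rewrite mcoeffB !mcoeffZ !mcoeffX eqxx [m' == m]eq_sym (negPf ne) mulr1 mulr0 subr0.
rewrite (@initial_formD _ _ wt _ _ w) //.
- by apply: contraNneq (C0 m) => f0; rewrite -invr_eq0 -fm f0 mcoeff0.
- move=> m0; rewrite mcoeff_msupp mcoeffB !mcoeffZ !mcoeffX.
  by have [<-//|_] := eqVneq m m0; have [<-//|_] := eqVneq m' m0; rewrite !mulr0 subrr eqxx.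
apply: heavy_sum => i _; have [->|ci] := eqVneq (c i) 0.
  by rewrite oppr0 scale0r; apply: heavy0.
by apply: heavyZ; apply: (heavyW (cw i ci)); apply: heavyX.
Qed.

Lemma in_plueckerE f : in_pluecker l f <-> monmap mexp sgn f = 0.
Proof.
split; first exact: in_pluecker_ker.
apply: (ker_monmap_le (@mf_sign_neq0 k n l K)); first exact: ideal_gen_is_ideal.
exact: kernel_binomial_in_pluecker.
Qed.

End InitialIdeal.

(** * Schubert conditions *)

Lemma toric_ext (K : fieldType) (N : nat) (J J' : {mpoly K[N]} -> Prop) :
  (forall f, J f <-> J' f) -> toric J -> toric J'.
Proof.
move=> E [[[J0 JD JM] J1 JP] [B [Bb BJ]]]; split.
  split; first split.
  - exact/E.
  - by move=> f g /E Jf /E Jg; apply/E/JD.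
  - by move=> a f /E Jf; apply/E/JM.
  - by move/E.
  by move=> f g /E/JP[] H; [left|right]; apply/E.
exists B; split=> // f; rewrite -BJ; split=> /E //.
Qed.

Section Schubert.
Variables (k n l : nat) (K : fieldType) (w : k.+2.-tuple nat).
Hypothesis charK0 : [pchar K] =i pred0.
Hypothesis l_le_n : (l <= n)%N.
Local Notation ksub := (ksubset k.+2 n).
Local Notation sgn := (@mf_sign k n l K).
Local Notation mexp := (@mf_exp k n l).
Local Notation row0 := (row0 k).
Local Notation row1 := (row1 k).

Lemma kill_varsE : @kill_vars k.+2 n K w = @restr_poly K ksub (@kset_le k.+2 n w).
Proof. by []. Qed.

Lemma schubert_toric :
  (forall s s' : seq ksub, \sum_(I <- s) mexp I = \sum_(I <- s') mexp I ->
    all (kset_le w) s -> all (kset_le w) s')%MM ->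
  toric (@schubert_ideal k.+2 n K l w).
Proof.
move=> H; pose phi := monmap (fun I : ksubset_below n w => mexp (val I))
  (fun I => sgn (val I)).
have c0 (I : ksubset_below n w) : sgn (val I) != 0 by apply: mf_sign_neq0.
apply: toric_ext (toric_ker_monmap (fun I : ksubset_below n w => mexp (val I)) c0).
move=> g; split=> [g0|[f /(in_plueckerE charK0 l_le_n) f0 ->]].
  exists (@ext_poly K ksub (kset_le w) g); last by rewrite kill_varsE ext_polyK.
  by apply/(in_plueckerE charK0 l_le_n); rewrite monmap_ext.
by rewrite kill_varsE; apply: monmap_restr.
Qed.

Lemma mf_col_mem (I : ksub) i : mf_col l I i \in val I.
Proof. exact: kelt_mem. Qed.

Lemma mf_col_inj (I J : ksub) : mf_col l I =1 mf_col l J -> I = J.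
Proof.
move=> E; apply: val_inj; apply/setP => x; apply/idP/idP => /kelt_surj[t <-].
  rewrite -(permKV (mf_perm l I) t) -/(mf_col l I _) E; exact: mf_col_mem.
rewrite -(permKV (mf_perm l J) t) -/(mf_col l J _) -E; exact: mf_col_mem.
Qed.

(** A lift [f] would contain [P_I] with coefficient 1. No other monomial has the same image, since
    degree and columns can be read off the rows, so nothing cancels that term in the kernel. *)
Lemma var_notin_schubert (I : ksubset_below n w) :
  ~ @schubert_ideal k.+2 n K l w (var K I).
Proof.
case=> f /(in_plueckerE charK0 l_le_n) f0 E.
have f1 : f@_(seqmn [:: val I]) = 1.
  rewrite -(mcoeff_restr_poly f [:: I]) -kill_varsE -E.
  by rewrite -[var K I](big_seq1 *%R) prod_var mcoeffX eqxx.
have Em m : mon_exp mexp m = mexp (val I) -> m = seqmn [:: val I].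
  move=> Em; rewrite -(mnseqK m); congr seqmn.
  have rows : (\sum_(J <- mnseq m) mexp J = \sum_(J <- [:: val I]) mexp J)%MM.
    by rewrite big_seq1.
  have := size_mf_exp rows; case: (mnseq m) rows => [|J [|]] // rows _.
  congr [:: _]; apply: mf_col_inj => i.
  by have /mf_exp_rows/(_ i) := rows; rewrite /= => p; have [] := @perm_small_eq _ _ [:: mf_col l (val I) i] isT p.
have := congr1 (mcoeff (mexp (val I))) f0; rewrite mcoeff0 mcoeff_monmap.
rewrite big_mkcond (bigD1_seq (seqmn [:: val I])) ?msupp_uniq //=; last first.
  by rewrite mcoeff_msupp f1 oner_eq0.
rewrite big1 ?addr0; last first.
  by move=> m ne; case: eqP => // /Em e; rewrite e eqxx in ne.
rewrite mon_exp_seqmn big_seq1 eqxx f1 mul1r => /eqP; apply/negP.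
by apply: mon_coeff_neq0; apply: mf_sign_neq0.
Qed.

(** The binomial in [P_I1 P_I2] and [P_J1 P_J2] loses its second term, leaving a product of two
    variables in the ideal, neither of which belongs to it. *)
Lemma schubert_not_toric (I1 I2 J1 J2 : ksub) :
  (forall i, perm_eq [:: mf_col l I1 i; mf_col l I2 i] [:: mf_col l J1 i; mf_col l J2 i]) ->
  kset_le w I1 -> kset_le w I2 -> ~~ kset_le w J1 ->
  ~ toric (@schubert_ideal k.+2 n K l w).
Proof.
move=> rows le1 le2 nle [[[_ _ JM] _ JP] _].
pose m := seqmn [:: I1; I2]; pose m' := seqmn [:: J1; J2].
have ne : m != m'.
  apply: contraNneq nle => /seqmn_perm p.
  suff : all (kset_le w) [:: J1; J2] by case/andP.
  by rewrite -(perm_all _ p) /= le1 le2.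
have E : mon_exp mexp m = mon_exp mexp m'.
  by rewrite !mon_exp_seqmn; apply/mf_exp_rows.
have := kernel_binomial_in_pluecker charK0 l_le_n ne E.
set f := kernel_binomial _ _ _ => fin.
have kf : kill_vars w f = (mon_coeff sgn m)^-1 *:
    (var K (Sub I1 le1 : ksubset_below n w) * var K (Sub I2 le2 : ksubset_below n w)).
  rewrite kill_varsE /f /kernel_binomial linearB !linearZ /= scalerN.
  rewrite !restr_poly_seqmn /= le1 le2 (negPf nle) /= scaler0 subr0; congr (_ *: _).
  by rewrite !insubT /= -prod_var big_cons big_seq1.
have : @schubert_ideal k.+2 n K l w
    (var K (Sub I1 le1 : ksubset_below n w) * var K (Sub I2 le2 : ksubset_below n w)).
  have := JM (mon_coeff sgn m)%:MP (kill_vars w f); rewrite kf mul_mpolyC scalerA.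
  rewrite mulfV ?scale1r; last by apply: mon_coeff_neq0; apply: mf_sign_neq0.
  by apply; exists f.
by case/JP; apply: var_notin_schubert.
Qed.

Hypothesis w_incr : sorted ltn w.
Hypothesis w_range : forall x, x \in (w : seq nat) -> (1 <= x <= n)%N.
Local Notation w_ := (tnth w).

Lemma w_ltn (i j : 'I_k.+2) : (i < j)%N -> (w_ i < w_ j)%N.
Proof.
move=> ij; rewrite !(tnth_nth 0%N); apply: (sorted_ltn_nth ltn_trans) => //;
  by rewrite inE size_tuple.
Qed.

Lemma w_bounds i : (1 <= w_ i <= n)%N.
Proof. by apply: w_range; apply: mem_tnth. Qed.

(** Rows from 2 on are untouched by the matching, and all columns in rows 0 and 1 stay below
    [w_ row1], so only the first entry needs care. If [l = 0] or [w_ row1 <= l], no member is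
    swapped. If [w_ row0 = l], all columns in row 1 of [s] are below [l], which bounds the first
    entries in [s']. If [w_ row1 = (w_ row0).+1], the bound on the second entry suffices. *)
Lemma kset_le_preserved :
  [\/ l = 0%N, w_ row0 = l, (w_ row1 <= l)%N | w_ row1 = (w_ row0).+1] \/ w_ row0 = 1%N ->
  forall s s' : seq ksub, (\sum_(I <- s) mexp I = \sum_(I <- s') mexp I)%MM ->
  all (kset_le w) s -> all (kset_le w) s'.
Proof.
move=> cond s s' /mf_exp_rows rows le_s; apply/allP => J Js'.
have mem i : exists2 A, A \in s & mf_col l A i = mf_col l J i.
  have : mf_col l J i \in [seq mf_col l A i | A <- s].
    by rewrite (perm_mem (rows i)); exact: (map_f (fun A : ksub => mf_col l A i)).
  by case/mapP=> A As ->; exists A.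
have le A t : A \in s -> (kelt A t < w_ t)%N by move/(allP le_s)/forallP; apply.
have lt01 (A : ksub) := @kelt_ltn _ _ A row0 row1 isT.
have col01 (A : ksub) (i : 'I_k.+2) : (i <= 1)%N -> A \in s -> (mf_col l A i < w_ row1)%N.
  move=> i1 As; apply: leq_ltn_trans (le A row1 As).
  have [->|->] : i = row0 \/ i = row1.
    by case: i i1 => [[|[|i]] ?] // _; [left|right]; apply: val_inj.
    by rewrite mf_col_row0; case: ifP => // _; apply: ltnW.
  by rewrite mf_col_row1; case: ifP => // _; apply: ltnW.
have [A As AE] := mem row0; have [B Bs BE] := mem row1.
have J1 : (kelt J row1 < w_ row1)%N.
  have := col01 _ row0 isT As; have := col01 _ row1 isT Bs.
  by rewrite AE BE mf_col_row0 mf_col_row1; case: ifP.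
have J0 : (kelt J row0 < w_ row0)%N.
  case: cond => [cond|w1].
    move: (congr1 val AE) (congr1 val BE) (lt01 J) (lt01 A) (lt01 B).
    move: (le A row0 As) (le B row0 Bs) (le A row1 As) J1.
    rewrite /= !mf_col_row0 !mf_col_row1.
    case: (boolP (swapped l A)); case: (boolP (swapped l B));
      case: (boolP (swapped l J)); rewrite /swapped => *; case: cond => cond; lia.
  (* For [w_ row0 = 1] every first entry in [s] is 0. Element 0 can only be a first entry, so the
     number of members containing it is visible in rows 0 and 1. *)
  have count0 (r : seq ksub) : count (fun C => kelt C row0 == 0 :> nat) r =
      (count (fun C => mf_col l C row0 == 0 :> nat) r +
       count (fun C => mf_col l C row1 == 0 :> nat) r)%N.
    elim: r => //= C r ->; rewrite mf_col_row0 mf_col_row1 addnACA; congr addn.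
    have /negPf C1 : kelt C row1 != 0 :> nat by rewrite -lt0n (leq_ltn_trans _ (lt01 C)).
    by case: ifP => _; rewrite C1 ?addn0.
  have count_col i : count (fun C => mf_col l C i == 0 :> nat) s =
      count (fun C => mf_col l C i == 0 :> nat) s'.
    have /seq.permP/(_ (fun x : 'I_n => x == 0 :> nat)) := rows i.
    by rewrite !count_map.
  have all0 : all (fun C : ksub => kelt C row0 == 0 :> nat) s'.
    rewrite all_count count0 -!count_col -count0 -(size_mf_exp (l := l) (s := s)).
      rewrite -all_count; apply/allP => C Cs; have := le C row0 Cs.
      by rewrite w1; case: (nat_of_ord _).
    exact/mf_exp_rows.
  by rewrite w1 ltnS leqn0; apply: (allP all0).
apply/forallP => t; have [t1|t1] := ltnP 1 t.
  have [C Cs] := mem t; rewrite !mf_col_tail // => <-; exact: le.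
have [->//|->//] : t = row0 \/ t = row1.
by case: t t1 => [[|[|t]] ?] // _; [left|right]; apply: val_inj.
Qed.

(** The tail takes the largest values that [w] allows, which leaves the first entry as the only
    possible violation. *)
Lemma two_row_kset (p q : nat) : (p < q)%N -> (q < w_ row1)%N ->
  exists I : ksub, forall i : 'I_k.+2, kelt I i =
    (if i == row0 then p else if i == row1 then q else (w_ i).-1) :> nat.
Proof.
move=> pq qw; pose f (i : 'I_k.+2) :=
  (if i == row0 then p else if i == row1 then q else (w_ i).-1).
have w1n := w_bounds row1.
have fn i : (f i < n)%N.
  by rewrite /f; have := w_bounds i; case: eqP => _; last case: eqP => _; lia.
have [I IE] : exists I : ksub, kelt I =1 fun i => Ordinal (fn i).
  apply: kset_of_incr => i j ij /=; rewrite /f.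
  have wij := w_ltn ij; have wi := w_bounds i.
  have j0 : j == row0 = false by apply/negbTE; apply: contraTneq ij => ->.
  rewrite j0; case: eqP => [_|/eqP i0].
    case: eqP => [//|/eqP j1].
    suff : (w_ row1 < w_ j)%N by lia.
    by apply: w_ltn; case: j j0 j1 {ij wij} => [[|[|j]]].
  have j1 : j == row1 = false.
    by apply/negbTE; apply: contraTneq ij => ->; case: i i0 {wij wi} => [[|]].
  by rewrite j1; case: eqP => [i1|_]; [rewrite i1 in wij; lia | lia].
by exists I => i; rewrite IE.
Qed.

Lemma crossing_pair : l <> 0%N -> (2 <= w_ row0)%N -> w_ row0 <> l ->
  (l < w_ row1)%N -> w_ row1 <> (w_ row0).+1 ->
  exists I1 I2 J1 J2 : ksub, [/\ forall i, perm_eq [:: mf_col l I1 i; mf_col l I2 i]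
     [:: mf_col l J1 i; mf_col l J2 i], kset_le w I1, kset_le w I2 & ~~ kset_le w J1].
Proof.
move=> l0 w1 w1l w2l w2.
have w12 : (w_ row0 < w_ row1)%N by apply: w_ltn.
have mk p q : (p < q)%N -> (q < w_ row1)%N -> exists I : ksub,
    (forall i, mf_col l I i = (if i == row0 then if (p < l <= q)%N then q else p else
       if i == row1 then if (p < l <= q)%N then p else q else (w_ i).-1) :> nat) /\
    kset_le w I = (p < w_ row0)%N.
  move=> pq qw; have [I IE] := two_row_kset pq qw; exists I.
  have sw : swapped l I = (p < l <= q)%N by rewrite /swapped !IE.
  split=> [i|].
    case: eqP => [->|/eqP i0]; first by rewrite mf_col_row0 sw; case: ifP; rewrite IE.
    case: eqP => [->|/eqP i1]; first by rewrite mf_col_row1 sw; case: ifP; rewrite IE.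
    rewrite mf_col_tail; last by case: i i0 i1 => [[|[|]]].
    by rewrite IE (negPf i0) (negPf i1).
  apply/forallP/idP => [/(_ row0)|pw i]; first by rewrite IE.
  rewrite IE; case: eqP => [->//|_]; case: eqP => [->//|_].
  by have := w_bounds i; lia.
have perm2 (x y x' y' : 'I_n) :
    (x = x' :> nat /\ y = y' :> nat) \/ (x = y' :> nat /\ y = x' :> nat) ->
    perm_eq [:: x; y] [:: x'; y'].
  case=> -[/val_inj-> /val_inj->]; first exact: perm_refl.
  by apply/allP => z _ /=; rewrite addnCA.
have [lw|wl] := ltnP l (w_ row0).
  (* The pairs starting at 0 are swapped, the others not: row 0 holds [l] and [w_ row0] on both
     sides, row 1 holds [(w_ row1).-1] and 0. The first entry [w_ row0] of [J1], counted from 0, is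
     one too large. *)
  have [I1 [e1 le1]] := mk l (w_ row1).-1 ltac:(lia) ltac:(lia).
  have [I2 [e2 le2]] := mk 0%N (w_ row0) ltac:(lia) ltac:(lia).
  have [J1 [e3 le3]] := mk (w_ row0) (w_ row1).-1 ltac:(lia) ltac:(lia).
  have [J2 [e4 le4]] := mk 0%N l ltac:(lia) ltac:(lia).
  exists I1, I2, J1, J2; split; rewrite ?le1 ?le2 ?le3; try lia.
  move=> i; apply: perm2; rewrite e1 e2 e3 e4.
  by case: eqP => _; last case: eqP => _; do ?[case: ifP => ?]; lia.
(* Now the pairs ending in [(w_ row1).-1] are the swapped ones: row 0 holds 0 and [(w_ row1).-1] on
   both sides, row 1 holds [l.-1] and [(w_ row0).-1]. Here [l.-1] is too large as first entry of
   [J1]. *)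
have [I1 [e1 le1]] := mk 0%N l.-1 ltac:(lia) ltac:(lia).
have [I2 [e2 le2]] := mk (w_ row0).-1 (w_ row1).-1 ltac:(lia) ltac:(lia).
have [J1 [e3 le3]] := mk l.-1 (w_ row1).-1 ltac:(lia) ltac:(lia).
have [J2 [e4 le4]] := mk 0%N (w_ row0).-1 ltac:(lia) ltac:(lia).
exists I1, I2, J1, J2; split; rewrite ?le1 ?le2 ?le3; try lia.
move=> i; apply: perm2; rewrite e1 e2 e3 e4.
by case: eqP => _; last case: eqP => _; do ?[case: ifP => ?]; lia.
Qed.

End Schubert.

(** * The one-row case and the equivalence *)

(** The minors of a single row are distinct variables, so the substitution has the left inverse
    given by [back]. *)
Lemma pluecker_ideal_row (K : fieldType) (n : nat) f : @pluecker_ideal 1 n K f -> f = 0.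
Proof.
move=> f0; pose back (ij : 'I_1 * 'I_n) : {mpoly K[#|ksubset 1 n|]} :=
  if [pick J : ksubset 1 n | kelt J ord0 == ij.2] is Some J then var K J else 0.
have minorK I : subst back (max_minor K I) = var K I.
  rewrite /max_minor det_mx11 !mxE subst_var /back; case: pickP => [J /eqP E|/(_ I)].
    by rewrite (@kelt_ext _ _ J I) // => t; rewrite (ord1 t).
  by rewrite eqxx.
have -> : f = subst back (subst (@max_minor 1 n K) f).
  rewrite {1}(mpolyE f) (substE (@max_minor 1 n K)) linear_sum; apply: eq_bigr => m _ /=.
  rewrite linearZ /= -(mnseqK m) subst_seqmn rmorph_prod -prod_var.
  by congr (_ *: _); apply: eq_bigr => I _; rewrite -minorK.
by rewrite (_ : subst _ f = 0) ?linear0.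
Qed.

Theorem theorem5p7 (K : fieldType) (charK0 : [pchar K] =i pred0)
    (k n l : nat) (k_gt0 : (1 <= k)%N) (k_le_n : (k <= n)%N) (l_le_n : (l <= n)%N)
    (w : k.-tuple nat) (w_incr : sorted ltn w)
    (w_range : forall x, x \in w -> (1 <= x <= n)%N)
    (nonzero : exists2 f, @schubert_ideal k n K l w f & f != 0) :
  ~ toric (@schubert_ideal k n K l w) <->
  [/\ l <> 0%N,
      (2 <= head 0%N w <= n - k)%N /\ head 0%N w <> l
    & forall x, x \in behead w ->
        (l.+1 <= x <= n)%N /\ x <> (head 0%N w).+1].
Proof.
case: k k_gt0 k_le_n w w_incr w_range nonzero => [//|[|k]] _ k_le_n w w_incr w_range nonzero.
  (* For one row the ideal is zero, which contradicts [nonzero]. *)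
  case: nonzero => _ [f fin ->] /eqP[].
  have -> : f = 0; last exact: linear0.
  have zid : is_ideal (fun g : {mpoly K[#|ksubset 1 n|]} => g = 0).
    by split=> [//|g h -> ->|a g ->]; rewrite ?addr0 ?mulr0.
  apply: (ideal_gen_le zid _ fin) => _ [g /pluecker_ideal_row -> ->].
  by rewrite /initial_form msupp0 big_nil.
have w0E : head 0%N w = tnth w (row0 k) by rewrite (tnth_nth 0%N) /= nth0.
have w1b : tnth w (row1 k) \in behead w.
  by rewrite (tnth_nth 0%N) /= -nth_behead mem_nth // size_behead size_tuple.
(* The conditions on the tail of [w] reduce to its least entry. *)
have w1_le x : x \in behead w -> (tnth w (row1 k) <= x)%N.
  case/(nthP 0%N) => i; rewrite size_behead size_tuple /= => ik <-.
  rewrite nth_behead (tnth_nth 0%N) /=; apply: (sorted_leq_nth leq_trans leqnn) => //.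
  - exact: sub_sorted ltnW _ w_incr.
  - by rewrite inE size_tuple.
  - by rewrite inE size_tuple.
(* There are [k] further entries after [row1]. Together with a gap of at least 2 between the first
   two entries, this gives the upper bound on the first entry in (ii). *)
have w_last : (tnth w (row1 k) + k <= n)%N.
  suff H i : (i <= k)%N -> (tnth w (row1 k) + i <= nth 0 w i.+1)%N.
    apply: leq_trans (H k (leqnn _)) _; apply: (andP (w_range _ _)).2.
    by apply: mem_nth; rewrite size_tuple.
  elim: i => [|i IH] ik; first by rewrite addn0 (tnth_nth 0%N).
  rewrite addnS; apply: leq_ltn_trans (IH (ltnW ik)) _.
  apply: (sorted_ltn_nth ltn_trans) => //; rewrite inE size_tuple //.
  by rewrite !ltnS ltnW.
have w0_gt0 := w_bounds w_range (row0 k).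
have w01 : (tnth w (row0 k) < tnth w (row1 k))%N by apply: w_ltn.
rewrite w0E; split.
  move=> nt.
  have ncond : ~ ([\/ l = 0%N, tnth w (row0 k) = l, (tnth w (row1 k) <= l)%N |
      tnth w (row1 k) = (tnth w (row0 k)).+1] \/ tnth w (row0 k) = 1%N).
    move=> cond; apply: nt; apply: schubert_toric => // s s'.
    exact: kset_le_preserved.
  have l0 : l <> 0%N by move=> e; apply: ncond; left; apply: Or41.
  have w0l : tnth w (row0 k) <> l by move=> e; apply: ncond; left; apply: Or42.
  have w1l : (l < tnth w (row1 k))%N.
    by rewrite ltnNge; apply/negP => e; apply: ncond; left; apply: Or43.
  have w10 : tnth w (row1 k) <> (tnth w (row0 k)).+1.
    by move=> e; apply: ncond; left; apply: Or44.
  have w0_1 : tnth w (row0 k) <> 1%N by move=> e; apply: ncond; right.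
  split=> //; first by split=> //; lia.
  move=> x xb; have := w1_le x xb; have := w_range x (mem_behead xb).
  by lia.
case=> l0 [/andP[w0_2 _] w0l] /(_ _ w1b) [/andP[w1l _] w10].
have [I1 [I2 [J1 [J2 [rows le1 le2 nle]]]]] :=
  crossing_pair l_le_n w_incr w_range l0 w0_2 w0l w1l w10.
exact: (schubert_not_toric charK0 l_le_n rows le1 le2 nle).
Qed.
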